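(* In the setting given in the context, suppose that $\Theta\subseteq\{\theta\in\mathbb R^d:\|\theta\|_2\le R\}$, that $\mu$ is uniform on the surface of the $\ell_2$-ball of radius $\sqrt d$ centered at $0$, and that $\mathbb E[\|\mathsf g(\theta;X)\|_2^2]\le G^2$ for all $\theta\in\Theta$. Let $\alpha,u>0$ and let $\{\theta^t\}$ be generated from an arbitrary $\theta^1\in\Theta$ by $$\theta^{t+1}=\operatorname*{argmin}_{\theta\in\Theta}\Big\{\langle g^t,\theta\rangle+\frac{1}{2\alpha(t)}\|\theta-\theta^t\|_2^2\Big\},\qquad g^t=\frac{F(\theta^t+u_tZ^t;X^t)-F(\theta^t;X^t)}{u_t}Z^t,$$ with $$\alpha(t)=\alpha\frac{R}{2G\sqrt d\sqrt t},\qquad u_t=u\,\frac{G\sqrt d}{L(P)\,d^{3/2}}\cdot\frac1t .$$ Then for all $k\ge1$, with $\widehat\theta(k)=\frac1k\sum_{t=1}^k\theta^t$, $$\mathbb E\big[f(\widehat\theta(k))-f(\theta^* )\big]\le2\,\frac{RG\sqrt d}{\sqrt k}\max\{\alpha,\alpha^{-1}\}+\alpha u^2\frac{RG\sqrt d}{k}+u\,\frac{RG\sqrt d\,\log(2k)}{k}.$$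
   Context: Problem: $\Theta\subseteq\mathbb R^d$ is a compact convex set, $P$ is a probability distribution on a space $\mathcal X$, for $P$-almost every $x$ the function $F(\cdot;x)$ is closed and convex, $f(\theta)=\mathbb E_P[F(\theta;X)]$, and $\theta^*$ is a minimizer of $f$ over $\Theta$. $X^1,X^2,\dots$ are i.i.d. from $P$, and $Z^1,Z^2,\dots$ are i.i.d. from $\mu$, independent of the $X^t$. $\mathsf g(\theta;x)\in\partial F(\theta;x)$ is a measurable subgradient selection with $\mathbb E[\mathsf g(\theta;X)]\in\partial f(\theta)$. Standing assumptions: the proximal function is $\psi(\theta)=\frac12\|\theta\|_2^2$, with Bregman divergence $D_\psi(\theta,\tau)=\frac12\|\theta-\tau\|_2^2$, and $D_\psi(\theta^*,\theta)\le\frac12R^2$ for all $\theta\in\Theta$ (that is, $\|\theta-\theta^*\|_2\le R$). $\operatorname{dom}F(\cdot;x)\supset\Theta+u_1\operatorname{supp}\mu$ for all $x\in\mathcal X$. There is $L:\mathcal X\to\mathbb R_+$ such that for $P$-a.e. $x$ the gradient of $F(\cdot;x)$ is $L(x)$-Lipschitz with respect to $\|\cdot\|_2$, and $L(P)=\sqrt{\mathbb E[L(X)^2]}$ is finite. The constants $R,G,L(P)$ are positive. *)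

(* Defs.v *)
From HB Require Import structures.
From mathcomp Require Export all_boot all_order all_algebra.
From mathcomp Require Export finmap.
From mathcomp Require Export all_classical all_reals all_analysis.
From mathcomp Require Export measurable_realfun.

Set Implicit Arguments.
Unset Strict Implicit.
Unset Printing Implicit Defensive.

Export Order.TTheory GRing.Theory Num.Theory.
Export numFieldNormedType.Exports.

Local Open Scope classical_set_scope.
Local Open Scope ring_scope.

(* 'rV[R]_d carries the max norm in the library; it induces the Euclidean
   topology, but every metric notion below uses norm2. *)
Definition dotp (R : realType) (d : nat) (x y : 'rV[R]_d) : R :=
  \sum_(i < d) x 0 i * y 0 i.

Definition norm2 (R : realType) (d : nat) (x : 'rV[R]_d) : R :=
  Num.sqrt (dotp x x).

Definition sphere2 (R : realType) (d : nat) (r : R) : set 'rV[R]_d :=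
  [set x | norm2 x = r].
Arguments sphere2 {R} d r.

(* R^d with its Borel sigma-algebra; convertible to 'rV[R]_d. *)
Notation borelRV R d := (g_sigma_algebraType (@open 'rV[R]_d)).

Section hausdorff_measure.
Context {R : realType} {d : nat}.
Local Open Scope ereal_scope.

Definition diam2 (A : set 'rV[R]_d) : \bar R :=
  ereal_sup [set (norm2 (x - y))%:E | x in A & y in A].

(* diam^m, where the empty set counts 0 and a singleton counts 0^0 = 1 when
   m = 0, so that the 0-dimensional measure is the counting measure. *)
Definition hausdorff_gauge (m : nat) (A : set 'rV[R]_d) : \bar R :=
  if A == set0 then 0 else diam2 A ^+ m.

Definition hausdorff_content (m : nat) (delta : R) (A : set 'rV[R]_d) :
    \bar R :=
  ereal_inf [set \sum_(0 <= i <oo) hausdorff_gauge m (U i) | U in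
    [set U : nat -> set 'rV[R]_d |
      A `<=` \bigcup_i U i /\ forall i, diam2 (U i) <= delta%:E]].

Definition hausdorff (m : nat) (A : set 'rV[R]_d) : \bar R :=
  ereal_sup [set hausdorff_content m delta A | delta in
    [set delta : R | (0 < delta)%R]].

End hausdorff_measure.

(* Normalized surface area, i.e. the (d-1)-dimensional Hausdorff measure of the
   sphere; its normalizing constant is irrelevant here. *)
Definition uniform_on_sphere (R : realType) (d : nat) (r : R)
    (mu : set (borelRV R d) -> \bar R) : Prop :=
  forall A : set (borelRV R d), measurable A ->
    mu A = (hausdorff d.-1 (A `&` sphere2 d r)
            / hausdorff d.-1 (sphere2 d r))%E.

Definition msupport (R : realType) (d : nat)
    (mu : set (borelRV R d) -> \bar R) : set 'rV[R]_d :=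
  [set z | forall U : set 'rV[R]_d, open U -> U z -> (0 < mu U)%E].

Section convex_analysis.
Context {R : realType} {d : nat}.
Implicit Types (h : 'rV[R]_d -> \bar R) (a b v : 'rV[R]_d).

Definition edom h : set 'rV[R]_d := [set a | (h a < +oo)%E].

(* Convex functions take values in ]-oo, +oo]; "closed" means that the
   epigraph is closed. *)
Definition closed_convex h : Prop :=
  [/\ forall a, h a != -oo%E,
      closed [set p : 'rV[R]_d * R | (h p.1 <= p.2%:E)%E] &
      forall a b (s : R), 0 <= s <= 1 ->
        (h (s *: a + (1 - s) *: b)%R <= s%:E * h a + (1 - s)%:E * h b)%E].

Definition subdifferential h a : set 'rV[R]_d :=
  [set v | forall b, (h a + (dotp v (b - a))%:E <= h b)%E].

Definition grad h a : 'rV[R]_d :=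
  \row_i 'D_(delta_mx 0 i) (fun b => fine (h b)) a.

(* The gradient of an extended-valued function is considered where it can
   exist, namely on the interior of the domain. *)
Definition lipschitz_gradient h (l : R) : Prop :=
  (forall a, (edom h)° a -> differentiable (fun b => fine (h b)) a) /\
  (forall a b, (edom h)° a -> (edom h)° b ->
     norm2 (grad h a - grad h b) <= l * norm2 (a - b)).

End convex_analysis.

Definition is_argmin (disp : Order.disp_t) (V : porderType disp) (T : Type)
    (D : set T) (h : T -> V) (x : T) : Prop :=
  D x /\ forall y, D y -> (h x <= h y)%O.

Section sequences_of_random_elements.
Context {dO dT dT' : measure_display} {Omega : measurableType dO}
  {T : measurableType dT} {T' : measurableType dT'} {R : realType}.
Variable Pr : probability Omega R.

Definition mutually_independent (X : nat -> Omega -> T) : Prop :=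
  forall (J : {fset nat}) (A : nat -> set T), (forall j, measurable (A j)) ->
    (Pr (\bigcap_(j in [set` J]) (X j @^-1` A j)) =
     \big[*%E/1%E]_(j <- J) Pr (X j @^-1` A j))%E.

Definition iid (P : probability T R) (X : nat -> Omega -> T) : Prop :=
  [/\ forall j, measurable_fun setT (X j),
      forall j (A : set T), measurable A -> Pr (X j @^-1` A) = P A &
      mutually_independent X].

Definition sigma_of (X : nat -> Omega -> T) : set (set Omega) :=
  <<s [set E | exists j (A : set T), measurable A /\ E = X j @^-1` A] >>.

End sequences_of_random_elements.

Definition independent_sequences (dO dT dT' : measure_display)
    (Omega : measurableType dO) (T : measurableType dT)
    (T' : measurableType dT') (R : realType) (Pr : probability Omega R)
    (X : nat -> Omega -> T) (Z : nat -> Omega -> T') : Prop :=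
  forall E H, sigma_of X E -> sigma_of Z H ->
    Pr (E `&` H) = (Pr E * Pr H)%E.

Section zero_order_method.
Context {R : realType} {d : nat} {dX : measure_display}
  {XX : measurableType dX}.
Implicit Types (P : probability XX R) (F : 'rV[R]_d -> XX -> \bar R).

Definition risk P F (theta : 'rV[R]_d) : \bar R := (\int[P]_x F theta x)%E.

Definition mean_vec P (g : XX -> 'rV[R]_d) : 'rV[R]_d :=
  \row_i fine (\int[P]_x (g x 0 i)%:E)%E.

Definition rms P (L : XX -> R) : R :=
  Num.sqrt (fine (\int[P]_x (L x ^+ 2)%:E)%E).

Definition step_size (rad G alpha : R) (t : nat) : R :=
  alpha * (rad / (2 * G * Num.sqrt d%:R * Num.sqrt t%:R)).

Definition smoothing (G LP u : R) (t : nat) : R :=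
  u * ((G * Num.sqrt d%:R) / (LP * d%:R `^ (3 / 2))) * (1 / t%:R).

(* F is finite at both points for almost all samples, so fine only discards
   a null event. *)
Definition grad_estimate F (v : R) (theta z : 'rV[R]_d) (x : XX) : 'rV[R]_d :=
  ((fine (F (theta + v *: z) x) - fine (F theta x)) / v) *: z.

Definition prox_objective (a : R) (g theta0 theta : 'rV[R]_d) : R :=
  dotp g theta + 1 / (2 * a) * norm2 (theta - theta0) ^+ 2.

End zero_order_method.

Arguments step_size {R} d rad G alpha t.
Arguments smoothing {R} d G LP u t.

(* The iterates theta 1, theta 2, ... are indexed from 1; theta 0 is junk. *)
Definition average (R : realType) (d : nat) (theta : nat -> 'rV[R]_d)
    (k : nat) : 'rV[R]_d :=
  k%:R^-1 *: \sum_(1 <= t < k.+1) theta t.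

(* Main.v *)
From HB Require Import structures.
Require Import Defs.
From mathcomp Require Import perm ring lra.

(** With w = theta - thetastar and gamma a subgradient of F(.; x) at theta, the
    descent lemma gives F(theta + v z; x) - F(theta; x) = v (<gamma, z> + e) with
    0 <= e <= v L(x) |z|^2 / 2, so the two-point estimate is (<gamma, z> + e) z.
    The uniform law on the sphere of radius sqrt d is invariant under sign
    changes and swaps of coordinates; hence E[z z^T] = I, and the estimate has
    mean close to gamma and second moment at most 2 d G^2 + d^3 v^2 L(P)^2 / 2.
    Since the prox step is a projected gradient step, it does not increase the
    distance to thetastar beyond that of the unprojected step, and conditioning
    on the past yields
      E |theta^{t+1} - thetastar|^2 <=
        E |theta^t - thetastar|^2 - 2 alpha(t) E[f(theta^t) - f(thetastar)] + c_t,
    c_t collecting the bias and second moment of the estimate.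
    Dividing by 2 alpha(t), summing by parts and applying Jensen's inequality
    gives the bound. *)

Set Implicit Arguments.
Unset Strict Implicit.
Unset Printing Implicit Defensive.

Local Open Scope classical_set_scope.
Local Open Scope ring_scope.

(** * The Euclidean inner product *)

(** Smoothness is assumed only on the interior of the domain, while the hypothesis on the domain
    provides just the points a + u_1 z with z in the support of [mu]. Symmetry of the support puts a
    cube around 0 into its convex hull; hence every a + s z with 0 <= s < u_1 is an interior point,
    which is where the descent inequality is derived. Conditioning is done without conditional
    expectations: by induction on t the law of (theta^t, X^t, Z^t) is a product, and Tonelli's
    theorem yields an iterated integral. This needs theta^{t+1} to be a measurable function of that
    triple, whereas it is given only as a minimizer; uniqueness and continuity of the projection
    supply such a function. The excess risk along the iterates is never shown to be measurable. It
    is bounded pointwise by a measurable quantity, and monotonicity of the integral of nonnegative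
    functions does the rest. All facts on the uniform law come from the invariance of Hausdorff
    measure under isometric involutions, so no surface area is computed and every d >= 1 is treated
    alike. *)

Section euclid.
Context {R : realType} {d : nat}.
Implicit Types (x y z : 'rV[R]_d) (c : R).

Lemma dotpC x y : dotp x y = dotp y x.
Proof. by apply: eq_bigr => i _; rewrite mulrC. Qed.

Lemma dotpDl x y z : dotp (x + y) z = dotp x z + dotp y z.
Proof. by rewrite -big_split; apply: eq_bigr => i _; rewrite mxE mulrDl. Qed.

Lemma dotpZl c x y : dotp (c *: x) y = c * dotp x y.
Proof. by rewrite mulr_sumr; apply: eq_bigr => i _; rewrite mxE mulrA. Qed.

Lemma dotpNl x y : dotp (- x) y = - dotp x y.
Proof. by rewrite -scaleN1r dotpZl mulN1r. Qed.

Lemma dotpDr x y z : dotp x (y + z) = dotp x y + dotp x z.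
Proof. by rewrite dotpC dotpDl dotpC (dotpC z). Qed.

Lemma dotpZr c x y : dotp x (c *: y) = c * dotp x y.
Proof. by rewrite dotpC dotpZl dotpC. Qed.

Lemma dotpNr x y : dotp x (- y) = - dotp x y.
Proof. by rewrite dotpC dotpNl dotpC. Qed.

Lemma dotp0l x : dotp 0 x = 0.
Proof. by rewrite -(scale0r 0) dotpZl mul0r. Qed.

Lemma dotp_sumr (I : Type) (r : seq I) (Q : pred I) (h : I -> 'rV[R]_d) x :
  dotp x (\sum_(i <- r | Q i) h i) = \sum_(i <- r | Q i) dotp x (h i).
Proof.
elim/big_rec2: _ => [|i y1 y2 _ IH]; first by rewrite dotpC dotp0l.
by rewrite dotpDr IH.
Qed.

Lemma dotp_ge0 x : 0 <= dotp x x.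
Proof. by apply: sumr_ge0 => i _; rewrite -expr2 sqr_ge0. Qed.

Lemma norm2_ge0 x : 0 <= norm2 x.
Proof. exact: sqrtr_ge0. Qed.

Lemma sqr_norm2 x : norm2 x ^+ 2 = dotp x x.
Proof. by rewrite sqr_sqrtr// dotp_ge0. Qed.

Lemma norm2N x : norm2 (- x) = norm2 x.
Proof. by rewrite /norm2 dotpNl dotpNr opprK. Qed.

Lemma norm2Z c x : norm2 (c *: x) = `|c| * norm2 x.
Proof.
by rewrite /norm2 dotpZl dotpZr mulrA -expr2 sqrtrM ?sqr_ge0// sqrtr_sqr.
Qed.

Lemma dotp_CS x y : `|dotp x y| <= norm2 x * norm2 y.
Proof.
rewrite -sqrtrM ?dotp_ge0// -sqrtr_sqr ler_sqrt; last first.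
  by rewrite mulr_ge0// dotp_ge0.
have [y0|y0] := eqVneq (dotp y y) 0.
  have hy i : y 0 i = 0.
    move: y0 => /eqP; rewrite psumr_eq0; last first.
      by move=> j _; rewrite -expr2 sqr_ge0.
    by move=> /allP/(_ i (mem_index_enum _))/=; rewrite mulf_eq0 orbb => /eqP.
  have -> : dotp x y = 0 by rewrite /dotp big1// => i _; rewrite hy mulr0.
  by rewrite y0 mulr0 expr0n.
have yp : 0 < dotp y y by rewrite lt0r y0 dotp_ge0.
(* The squared norm of this vector is [dotp y y] times the gap in the squared inequality. *)
have := dotp_ge0 (dotp y y *: x - dotp x y *: y).
rewrite !(dotpDl, dotpDr, dotpNl, dotpNr, dotpZl, dotpZr) (dotpC y x).
move=> h; rewrite -subr_ge0 -(pmulr_rge0 _ yp); move: h; congr (0 <= _); ring.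
Qed.

Lemma dotp_sqrB x y : dotp (x - y) (x - y) = dotp x x - 2 * dotp x y + dotp y y.
Proof.
rewrite !(dotpDl, dotpDr, dotpNl, dotpNr) (dotpC y x); ring.
Qed.

Lemma ler_coord_norm2 x i : `|x 0 i| <= norm2 x.
Proof.
rewrite -sqrtr_sqr ler_sqrt ?dotp_ge0// /dotp (bigD1 i)//= -expr2 lerDl.
by apply: sumr_ge0 => j _; rewrite -expr2 sqr_ge0.
Qed.

End euclid.

(** * The Borel sigma-algebra of R^d *)

Section borel_rV.
Context {R : realType} {d : nat}.

(** Cubes with rational centre and half-side 1/(n+1): a base of the topology indexed by a countable
    type. *)
Definition rat_ball (c : 'rV[rat]_d * nat) : set 'rV[R]_d :=
  [set y | forall i, `|ratr (c.1 0 i) - y 0 i| < c.2.+1%:R^-1].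

Lemma rat_ball_basis (U : set 'rV[R]_d) x : open U -> U x ->
  exists c, rat_ball c x /\ rat_ball c `<=` U.
Proof.
move=> oU Ux; have /nbhs_ballP[e /= e0 eU] : nbhs x U by exact: open_nbhs_nbhs.
have [n ne] : exists n, n.+1%:R^-1 < e / 2 :> R.
  have [n _ nP] := near_infty_natSinv_lt (PosNum (divr_gt0 e0 (ltr0n R 2))).
  by exists n; exact: (nP n (leqnn _)).
have /choice[q hq] : forall i, exists q : rat, `|ratr q - x 0 i| < n.+1%:R^-1 :> R.
  move=> i; have n0 : (0 : R) < n.+1%:R^-1 by rewrite invr_gt0.
  have lt_r : x 0 i - n.+1%:R^-1 < x 0 i + n.+1%:R^-1.
    by rewrite ltrBlDr -addrA ltrDl addr_gt0.
  have [q hq] := rat_in_itvoo lt_r.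
  by exists q; move: hq; rewrite in_itv/= ltr_distl.
exists (\row_i q i, n); split=> [i|y hy]; first by rewrite mxE.
apply: eU; split=> // i j; rewrite ord1.
rewrite -ball_normE /=; have := hy j; have := hq j; rewrite !mxE /= => h1 h2.
rewrite (le_lt_trans (ler_distD (ratr (q j)) _ _))// distrC.
by rewrite (lt_trans (ltrD h1 h2))// [ltRHS](Num.Theory.splitr e) ltrD.
Qed.

Lemma open_rat_balls (U : set 'rV[R]_d) : open U ->
  U = \bigcup_(c in [set c | rat_ball c `<=` U]) rat_ball c.
Proof.
move=> oU; apply/seteqP; split=> x; last by move=> [c cU]; exact: cU.
by move=> /(rat_ball_basis oU)[c [? ?]]; exists c.
Qed.

Lemma rat_ball_open c : open (rat_ball c).
Proof.
suff cH (y : 'rV[R]_d) : rat_ball c y -> nbhs y (rat_ball c).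
  by rewrite openE => y cy; exact: cH.
move=> cy.
have FF : Filter (nbhs y) by exact: nbhs_filter.
have := @filter_forall 'rV[R]_d 'I_d
  (fun i (z : 'rV[R]_d) => `|ratr (c.1 0 i) - z 0 i| < c.2.+1%:R^-1) (nbhs y) FF.
apply => i.
have cvg_y : (fun z : 'rV[R]_d => `|ratr (c.1 0 i) - z 0 i|) @ y -->
    `|ratr (c.1 0 i) - y 0 i|.
  apply: cvg_norm; apply: cvgB; [exact: cvg_cst|exact: coord_continuous].
exact: (cvgr_lt _ cvg_y).
Qed.

Lemma open_borel (U : set 'rV[R]_d) : open U ->
  measurable (U : set (borelRV R d)).
Proof. by move=> oU; exact: sub_sigma_algebra. Qed.

Lemma continuous_borel_real (f : 'rV[R]_d -> R) : continuous f ->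
  measurable_fun setT (f : borelRV R d -> R).
Proof.
move=> cf; apply: (measurability _ (RGenOpens.measurableE R)).
move=> _ [_ [a [b ->]] <-]; rewrite setTI; apply: open_borel.
by apply: open_comp => // x _; exact: cf.
Qed.

Lemma measurable_coord i : measurable_fun setT (fun x : borelRV R d => x 0 i).
Proof. by apply: continuous_borel_real => x; exact: coord_continuous. Qed.

(** Every open set is a countable union of rational cubes, and each cube is a finite intersection of
    coordinate slabs. *)
Lemma rV_measurable (dT : measure_display) (T : measurableType dT)
    (f : T -> borelRV R d) :
  (forall i, measurable_fun setT (fun w => f w 0 i)) -> measurable_fun setT f.
Proof.
move=> mf; apply: (@measurability _ _ _ (borelRV R d) _ _ (@open 'rV[R]_d) erefl).
move=> _ [U oU <-]; rewrite setTI (open_rat_balls oU) preimage_bigcup.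
rewrite bigcup_mkcond; apply: countable_bigcupT_measurable => // c.
case: ifP => // _.
have -> : f @^-1` rat_ball c = \bigcap_(i in [set: 'I_d])
    ((fun w => f w 0 i) @^-1` `](ratr (c.1 0 i) - c.2.+1%:R^-1),
      (ratr (c.1 0 i) + c.2.+1%:R^-1)[%classic).
  apply/seteqP; split=> [w hw i _|w hw i].
    by have := hw i; rewrite /= in_itv/= distrC ltr_distl.
  by have := hw i I; rewrite /= in_itv/= distrC ltr_distl.
apply: fin_bigcap_measurable => // i _; rewrite -[X in measurable X]setTI.
by apply: mf => //; exact: measurable_itv.
Qed.

Lemma continuous_borel (f : 'rV[R]_d -> 'rV[R]_d) : continuous f ->
  measurable_fun setT (f : borelRV R d -> borelRV R d).
Proof.
move=> cf; apply: (@measurability _ _ _ (borelRV R d) _ _ (@open 'rV[R]_d) erefl).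
move=> _ [U oU <-]; rewrite setTI; apply: open_borel.
by apply: open_comp => // x _; exact: cf.
Qed.

(** A point off the support has a null open neighbourhood, hence lies in a null rational cube, and
    there are countably many of these. Indices that encode no null cube contribute the empty set. *)
Lemma msupport_full (mu : probability (borelRV R d) R) :
  {ae mu, forall z, msupport mu z}.
Proof.
pose B n : set (borelRV R d) :=
  if (choice.unpickle n : option ('rV[rat]_d * nat)) is Some c then
  if `[< mu (rat_ball c) = 0%E >] then rat_ball c else set0 else set0.
suff sB : ~` msupport mu `<=` \bigcup_n B n.
  suff nB : mu.-negligible (\bigcup_n B n) by (exact: (@negligibleS _ _ _ mu _ _ sB nB)).
  apply: negligible_bigcup => n; rewrite /B.
  case: choice.unpickle => [c|]; last exact: negligible_set0.
  case: asboolP => [c0|_]; last exact: negligible_set0.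
  by exists (rat_ball c); split => //; apply: open_borel; exact: rat_ball_open.
move=> z /existsNP[U] /not_implyP[oU] /not_implyP[Uz mU].
have [c [zc cU]] := rat_ball_basis oU Uz.
exists (choice.pickle c) => //; rewrite /B choice.pickleK asboolT//.
apply/eqP; rewrite eq_le measure_ge0 andbT.
rewrite (le_trans (le_measure mu _ _ cU)) ?inE//; last by rewrite leNgt; exact/negP.
- by apply: open_borel; exact: rat_ball_open.
- exact: open_borel.
Qed.

End borel_rV.

(** * Invariance of the uniform law on the sphere *)

Lemma rV_continuous (R : realType) (T : topologicalType) d (h : T -> 'rV[R]_d) :
  (forall i, continuous (fun x => h x 0 i)) -> continuous h.
Proof.
move=> ch x; apply/cvgrPdist_lt => e e0.
have : \forall y \near x, forall i, `|h x 0 i - h y 0 i| < e.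
  by apply: filter_forall => i; move/cvgrPdist_lt : (ch i x); exact.
apply: filterS => y hy.
suff : ball (h x) e (h y) by rewrite -ball_normE.
by split=> // i j; rewrite ord1 -ball_normE /=; exact: hy.
Qed.

Section isometric_involutions.
Context {R : realType} {d : nat}.
Implicit Types (phi : 'rV[R]_d -> 'rV[R]_d).

Let isometric phi := forall x y, norm2 (phi x - phi y) = norm2 (x - y).

Lemma hausdorff0 m : hausdorff m (set0 : set 'rV[R]_d) = 0%E.
Proof.
have gauge_ge0 (A : set 'rV[R]_d) : (0 <= hausdorff_gauge m A)%E.
  rewrite /hausdorff_gauge; case: ifPn => // /set0P[x Ax].
  apply: expe_ge0; apply: ereal_sup_ubound; exists x => //; exists x => //.
  by rewrite subrr /norm2 dotp0l sqrtr0.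
apply/eqP; rewrite eq_le; apply/andP; split.
  apply: ge_ereal_sup => _ [e e0 <-]; apply: ereal_inf_lbound.
  exists (fun=> set0); last by rewrite eseries0// => i _ _; rewrite /hausdorff_gauge eqxx.
  split=> // i; apply: ge_ereal_sup => _ [x []].
apply: (@le_trans _ _ (hausdorff_content m 1 (set0 : set 'rV[R]_d))).
  by apply: le_ereal_inf_tmp => _ [U _ <-]; apply: nneseries_ge0 => i _ _.
by apply: ereal_sup_ubound; exists 1 => //=; exact: ltr01.
Qed.

(** An involution is onto, so preimages turn a cover of [A] into a cover of its preimage with the
    same diameters. The converse inequality is this one applied to the preimage. *)
Lemma hausdorff_involution_le phi m (A : set 'rV[R]_d) :
  isometric phi -> involutive phi ->
  (hausdorff m (phi @^-1` A) <= hausdorff m A)%E.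
Proof.
move=> iphi vphi.
have diamE (B : set 'rV[R]_d) : diam2 (phi @^-1` B) = diam2 B.
  congr ereal_sup; apply/seteqP; split=> _ [x xB [y yB <-]].
    by exists (phi x) => //; exists (phi y) => //; rewrite iphi.
  exists (phi x); first by rewrite /= vphi.
  by exists (phi y); [rewrite /= vphi|rewrite iphi].
apply: ge_ereal_sup => _ [e e0 <-].
apply: (@le_trans _ _ (hausdorff_content m e A)); last first.
  by apply: ereal_sup_ubound; exists e.
apply: le_ereal_inf_tmp => _ [U [AU dU] <-].
have -> : (\sum_(0 <= i <oo) hausdorff_gauge m (U i) =
           \sum_(0 <= i <oo) hausdorff_gauge m (phi @^-1` U i))%E.
  apply: eq_eseriesr => i _; rewrite /hausdorff_gauge diamE.
  have -> // : (phi @^-1` U i == set0) = (U i == set0).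
  apply/eqP/eqP => [U0|->]; last by rewrite preimage_set0.
  rewrite -subset0 => x Ux; have : (phi @^-1` U i) (phi x) by rewrite /= vphi.
  by rewrite U0.
apply: ereal_inf_lbound; exists (fun i => phi @^-1` U i) => //; split.
  by move=> x Ax; have [i _ Ui] := AU _ Ax; exists i.
by move=> i; rewrite diamE.
Qed.

Lemma hausdorff_involution phi m (A : set 'rV[R]_d) :
  isometric phi -> involutive phi -> hausdorff m (phi @^-1` A) = hausdorff m A.
Proof.
move=> iphi vphi; apply/eqP; rewrite eq_le hausdorff_involution_le//=.
rewrite -{1}(_ : phi @^-1` (phi @^-1` A) = A) ?hausdorff_involution_le//.
by apply/seteqP; split => x /=; rewrite vphi.
Qed.

(** The sphere is its own preimage under [phi], so the two numerators are the Hausdorff measures of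
    a set and of its preimage, over the same denominator. *)
Lemma uniform_involution phi r (mu : probability (borelRV R d) R) :
  uniform_on_sphere r mu -> continuous phi -> isometric phi -> involutive phi ->
  (forall x, norm2 (phi x) = norm2 x) ->
  forall A : set (borelRV R d), measurable A -> mu (phi @^-1` A) = mu A.
Proof.
move=> umu cphi iphi vphi nphi A mA.
have mphi := continuous_borel cphi.
rewrite !umu//; last by rewrite -[X in measurable X]setTI; exact: mphi.
congr (_ / _)%E; rewrite -[in RHS](@hausdorff_involution phi)//.
congr hausdorff; apply/seteqP.
by split=> x [xA xs]; split => //; move: xs; rewrite /sphere2 /= nphi.
Qed.

Lemma msupport_involution phi (mu : probability (borelRV R d) R) :
  continuous phi ->
  (forall A : set (borelRV R d), measurable A -> mu (phi @^-1` A) = mu A) ->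
  forall z, msupport mu z -> msupport mu (phi z).
Proof.
move=> cphi imu z sz U oU Uz.
have := imu U (open_borel oU) => <-; apply: sz => //.
by apply: open_comp => // x _; exact: cphi.
Qed.

Definition flip (i : 'I_d) (x : 'rV[R]_d) : 'rV[R]_d :=
  \row_j (if j == i then - x 0 j else x 0 j).

Definition swap (i k : 'I_d) (x : 'rV[R]_d) : 'rV[R]_d :=
  \row_j x 0 (tperm i k j).

Lemma flip_continuous i : continuous (flip i).
Proof.
apply: rV_continuous => j.
have -> : (fun x => flip i x 0 j) = (fun x => if j == i then - x 0 j else x 0 j).
  by apply/funext => x; rewrite mxE.
case: eqP => _ x; last exact: coord_continuous.
have := @coord_continuous R 1 d 0 j x; move=> /cvgN; apply; exact: nbhs_filter.
Qed.

Lemma swap_continuous i k : continuous (swap i k).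
Proof.
apply: rV_continuous => j.
have -> : (fun x => swap i k x 0 j) = (fun x => x 0 (tperm i k j)).
  by apply/funext => x; rewrite mxE.
by move=> x; exact: coord_continuous.
Qed.

Lemma flipK i : involutive (flip i).
Proof. by move=> x; apply/rowP => j; rewrite !mxE; case: eqP; rewrite ?opprK. Qed.

Lemma swapK i k : involutive (swap i k).
Proof. by move=> x; apply/rowP => j; rewrite !mxE tpermK. Qed.

Lemma flipB i x y : flip i (x - y) = flip i x - flip i y.
Proof. by apply/rowP => j; rewrite !mxE; case: ifP => //; rewrite opprD. Qed.

Lemma swapB i k x y : swap i k (x - y) = swap i k x - swap i k y.
Proof. by apply/rowP => j; rewrite !mxE. Qed.

Lemma norm2_flip i x : norm2 (flip i x) = norm2 x.
Proof.
congr Num.sqrt; apply: eq_bigr => j _; rewrite mxE; case: ifP => // _.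
by rewrite mulrNN.
Qed.

Lemma norm2_swap i k x : norm2 (swap i k x) = norm2 x.
Proof.
congr Num.sqrt; rewrite [RHS](reindex_inj (@perm_inj _ (tperm i k))).
by apply: eq_bigr => j _; rewrite mxE.
Qed.

Section uniform.
Variables (r : R) (mu : probability (borelRV R d) R).
Hypothesis umu : uniform_on_sphere r mu.

Lemma uniform_flip i (A : set (borelRV R d)) :
  measurable A -> mu (flip i @^-1` A) = mu A.
Proof.
apply: (uniform_involution umu); [exact: flip_continuous| |exact: flipK|exact: norm2_flip].
by move=> x y; rewrite -flipB norm2_flip.
Qed.

Lemma uniform_swap i k (A : set (borelRV R d)) :
  measurable A -> mu (swap i k @^-1` A) = mu A.
Proof.
apply: (uniform_involution umu); [exact: swap_continuous| |exact: swapK|exact: norm2_swap].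
by move=> x y; rewrite -swapB norm2_swap.
Qed.

Lemma norm2_borel : measurable_fun setT (@norm2 R d : borelRV R d -> R).
Proof.
apply: measurableT_comp; first by apply: continuous_measurable_fun; exact: sqrt_continuous.
rewrite (_ : (fun x => dotp x x) = fun x => \sum_(i < d) x 0 i * x 0 i)//.
by apply: measurable_sum => i; apply: measurable_funM; exact: measurable_coord.
Qed.

Lemma uniform_sphere_ae : {ae mu, forall z, norm2 z = r}.
Proof.
suff nB : mu.-negligible (~` sphere2 d r) by exact: nB.
have mS : measurable (sphere2 d r : set (borelRV R d)).
  by have := norm2_borel measurableT (measurable_set1 r); rewrite setTI.
exists (~` sphere2 d r); split => //; first exact: measurableC.
rewrite umu; last exact: measurableC.
by rewrite setICl hausdorff0 mul0e.
Qed.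

End uniform.
End isometric_involutions.

(** * Means of real random variables *)

Section almost_everywhere_probability.
Context {dT : measure_display} {T : measurableType dT} {R : realType}.
Variable mu : probability T R.
Implicit Types P Q : T -> Prop.

Let ae_filter : Filter (almost_everywhere mu).
Proof. exact: (@ae_filter_ringOfSetsType _ _ _ mu). Qed.

Lemma ae_mono P Q : (forall x, P x -> Q x) -> {ae mu, forall x, P x} -> {ae mu, forall x, Q x}.
Proof. exact: (@filterS _ _ ae_filter). Qed.

Lemma ae_and P Q : {ae mu, forall x, P x} -> {ae mu, forall x, Q x} ->
  {ae mu, forall x, P x /\ Q x}.
Proof. exact: (@filterI _ _ ae_filter). Qed.

Lemma ae_ex P : {ae mu, forall x, P x} -> exists x, P x.
Proof.
move=> aeP; apply: contrapT => /forallNP nP.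
have [A [mA A0 sA]] : mu.-negligible (~` [set x | P x]) by exact: aeP.
have AT : A = setT by apply/seteqP; split => // x _; apply: sA; exact: nP.
by have := probability_setT mu; rewrite -AT A0 => /esym/eqP; rewrite onee_eq0.
Qed.

End almost_everywhere_probability.

Section has_mean.
Context {dT : measure_display} {T : measurableType dT} {R : realType}.
Variable mu : probability T R.
Implicit Types (h : T -> R) (m c : R).

(** Integrability and a real value in one statement, so that computations with means take place in
    [R] instead of the extended reals. *)
Definition has_mean h m :=
  mu.-integrable setT (EFin \o h) /\ (\int[mu]_x (h x)%:E = m%:E)%E.

Lemma has_mean_measurable h m : has_mean h m -> measurable_fun setT h.
Proof. by move=> [/measurable_int/measurable_EFinP]. Qed.

Lemma has_mean_cst c : has_mean (fun=> c) c.
Proof.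
split; first exact: finite_measure_integrable_cst.
by rewrite (integral_cst mu measurableT c%:E)/= probability_setT mule1.
Qed.

Lemma has_meanD h1 h2 m1 m2 :
  has_mean h1 m1 -> has_mean h2 m2 -> has_mean (fun x => h1 x + h2 x) (m1 + m2).
Proof.
move=> [i1 e1] [i2 e2]; split; first exact: (integrableD measurableT i1 i2).
under eq_integral do rewrite EFinD.
by rewrite (integralD measurableT i1 i2) /= e1 e2.
Qed.

Lemma has_meanZ c h m : has_mean h m -> has_mean (fun x => c * h x) (c * m).
Proof.
move=> [i e]; split; first exact: (integrableZl measurableT c i).
under eq_integral do rewrite EFinM.
by rewrite (integralZl measurableT i) /= e.
Qed.

Lemma has_meanB h1 h2 m1 m2 :
  has_mean h1 m1 -> has_mean h2 m2 -> has_mean (fun x => h1 x - h2 x) (m1 - m2).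
Proof.
move=> h1m /(has_meanZ (-1)) h2m; have := has_meanD h1m h2m.
by under eq_fun do rewrite mulN1r; rewrite mulN1r.
Qed.

Lemma has_mean_sum (I : Type) (s : seq I) (Q : pred I) (h : I -> T -> R) (m : I -> R) :
  (forall i, Q i -> has_mean (h i) (m i)) ->
  has_mean (fun x => \sum_(i <- s | Q i) h i x) (\sum_(i <- s | Q i) m i).
Proof.
move=> hm; elim: s => [|i s IH].
  by under eq_fun do rewrite big_nil; rewrite big_nil; exact: has_mean_cst.
under eq_fun do rewrite big_cons; rewrite big_cons.
by case: ifP => // Qi; apply: has_meanD => //; exact: hm.
Qed.

Lemma has_mean_ge0 h (b : R) : measurable_fun setT h -> (forall x, 0 <= h x) ->
  (\int[mu]_x (h x)%:E <= b%:E)%E -> exists2 m, has_mean h m & 0 <= m <= b.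
Proof.
move=> mh h0 hb.
have int_ge0 : (0 <= \int[mu]_x (h x)%:E)%E.
  by apply: integral_ge0 => x _; rewrite lee_fin.
exists (fine (\int[mu]_x (h x)%:E)).
  split; last by rewrite fineK// ge0_fin_numE// (le_lt_trans hb)// ltry.
  apply/integrableP; split; first exact/measurable_EFinP.
  under eq_integral do rewrite /= ger0_norm//.
  by rewrite (le_lt_trans hb)// ltry.
by rewrite fine_ge0//= -lee_fin fineK// ge0_fin_numE// (le_lt_trans hb)// ltry.
Qed.

Lemma has_mean_ae_bounded h c : measurable_fun setT h ->
  {ae mu, forall x, `|h x| <= c} -> exists m, has_mean h m.
Proof.
move=> mh hc; have mEh : measurable_fun setT (EFin \o h) by exact/measurable_EFinP.
have ih : mu.-integrable setT (EFin \o h).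
  apply/integrableP; split => //.
  apply: (@le_lt_trans _ _ (\int[mu]_x (cst `|c|%:E x))%E).
    apply: ae_ge0_le_integral => //.
    - exact: measurableT_comp.
    - by move=> x _; rewrite lee_fin.
    - by apply: ae_mono hc => x hx _; rewrite lee_fin (le_trans hx)// ler_norm.
  by rewrite integral_cst//= probability_setT mule1 ltry.
exists (fine (\int[mu]_x (h x)%:E)); split => //.
by rewrite fineK//; exact: integrable_fin_num.
Qed.

Lemma has_mean_ae_le h1 h2 m1 m2 : has_mean h1 m1 -> has_mean h2 m2 ->
  {ae mu, forall x, h1 x <= h2 x} -> m1 <= m2.
Proof.
move=> h1m h2m h12.
have [mh1 mh2] := (has_mean_measurable h1m, has_mean_measurable h2m).
have [_ e] := has_meanB h2m h1m.
rewrite -subr_ge0 -lee_fin -e.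
(* The difference is nonnegative only almost everywhere; its absolute value agrees with it there and
   is nonnegative everywhere. *)
rewrite (_ : (\int[mu]_x _ = \int[mu]_x `|(h2 x - h1 x)%:E|)%E); last first.
  apply: ae_eq_integral => //.
  - by apply/measurable_EFinP; exact: measurable_funB.
  - by apply: measurableT_comp => //; apply/measurable_EFinP; exact: measurable_funB.
  - by apply: ae_mono h12 => x hx _; rewrite /= ger0_norm// subr_ge0.
exact: integral_ge0.
Qed.

Lemma has_mean_ae_eq h1 h2 m1 m2 : has_mean h1 m1 -> has_mean h2 m2 ->
  {ae mu, forall x, h1 x = h2 x} -> m1 = m2.
Proof.
move=> h1m h2m e; apply/eqP; rewrite eq_le.
by apply/andP; split; [apply: (has_mean_ae_le h1m h2m)|apply: (has_mean_ae_le h2m h1m)];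
  apply: ae_mono e => x ->.
Qed.

Lemma has_mean_unique h m1 m2 : has_mean h m1 -> has_mean h m2 -> m1 = m2.
Proof. by move=> [_ e1] [_]; rewrite e1 => -[]. Qed.

Lemma has_mean_comp_invariant (phi : T -> T) h m : measurable_fun setT phi ->
  (forall A, measurable A -> mu (phi @^-1` A) = mu A) ->
  has_mean h m -> has_mean (h \o phi) m.
Proof.
move=> mphi phi_mu [ih eh].
have mh := measurable_int mu ih.
have pE (f : T -> \bar R) : (\int[pushforward mu phi]_x f x = \int[mu]_x f x)%E.
  by apply: eq_measure_integral => A mA _; exact: phi_mu.
have iphi : mu.-integrable setT ((EFin \o h) \o phi).
  apply/integrableP; split; first exact: measurableT_comp.
  have mn : measurable_fun setT (fun x => `|(EFin \o h) x|%E) by exact: measurableT_comp.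
  have := ge0_integral_pushforward mphi mu measurableT mn (fun x _ => abse_ge0 _).
  rewrite preimage_setT pE => <-.
  by move/integrableP : ih => [].
split => //.
have := integral_pushforward mphi mh iphi measurableT.
by rewrite preimage_setT pE /= => <-.
Qed.

End has_mean.

(** * Second moments of the uniform law *)

Section uniform_moments.
Context {R : realType} {d : nat}.
Variable mu : probability (borelRV R d) R.
Hypothesis d0 : (0 < d)%N.
Hypothesis umu : uniform_on_sphere (Num.sqrt d%:R) mu.

(** For i <> j, flipping coordinate i negates the product, so its mean is its own opposite. Swaps
    make the diagonal means equal, and these add up to d because |z|^2 = d almost surely. *)
Lemma uniform_coord2 i j :
  has_mean mu (fun z : borelRV R d => z 0 i * z 0 j) (i == j)%:R.
Proof.
have mz k : measurable_fun setT (fun z : borelRV R d => z 0 k) by exact: measurable_coord.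
have ex k l : exists m, has_mean mu (fun z : borelRV R d => z 0 k * z 0 l) m.
  apply: (@has_mean_ae_bounded _ _ _ mu _ d%:R); first exact: measurable_funM.
  apply: ae_mono (uniform_sphere_ae umu) => z nz.
  rewrite normrM -(@sqr_sqrtr _ d%:R)// -nz expr2.
  by apply: ler_pM => //; exact: ler_coord_norm2.
have [m hm] := ex i j; suff -> : (i == j)%:R = m by [].
have [ij|ij] := eqVneq i j; last first.
  have := has_mean_comp_invariant (continuous_borel (@flip_continuous R d i))
    (uniform_flip umu i) hm.
  rewrite (_ : _ \o _ = fun z : borelRV R d => -1 * (z 0 i * z 0 j)); last first.
    by apply/funext => z /=; rewrite !mxE eqxx eq_sym (negbTE ij) mulN1r mulNr.
  by move=> /(has_mean_unique (has_meanZ (-1) hm)) /=; lra.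
rewrite -{j}ij in hm *.
have hk k : has_mean mu (fun z : borelRV R d => z 0 k * z 0 k) m.
  have := has_mean_comp_invariant (continuous_borel (@swap_continuous R d i k))
    (uniform_swap umu i k) hm.
  by congr has_mean; apply/funext => z /=; rewrite !mxE tpermL.
have hs := has_mean_sum (index_enum 'I_d) (fun k (_ : xpredT k) => hk k).
have /esym : \sum_(k < d) m = d%:R.
  apply: (has_mean_ae_eq hs (has_mean_cst mu d%:R)).
  apply: ae_mono (uniform_sphere_ae umu) => z nz.
  by rewrite -[RHS](@sqr_sqrtr _ d%:R)// -nz sqr_norm2.
rewrite sumr_const card_ord => e.
have dn0 : d%:R != 0 :> R by rewrite pnatr_eq0 -lt0n.
by apply: (mulfI dn0); rewrite [RHS]mulr_natl -e mulr1.
Qed.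

Lemma uniform_dotp2 (a b : 'rV[R]_d) :
  has_mean mu (fun z : borelRV R d => dotp a z * dotp z b) (dotp a b).
Proof.
rewrite (_ : (fun z : borelRV R d => _) = fun z : borelRV R d =>
    \sum_(i < d) \sum_(j < d) a 0 i * b 0 j * (z 0 i * z 0 j)); last first.
  apply/funext => z; rewrite /dotp mulr_suml; apply: eq_bigr => i _.
  by rewrite mulr_sumr; apply: eq_bigr => j _; ring.
rewrite (_ : dotp a b = \sum_(i < d) \sum_(j < d) a 0 i * b 0 j * (i == j)%:R).
  by do 2 (apply: has_mean_sum => ? _); apply: has_meanZ; exact: uniform_coord2.
apply: eq_bigr => i _; rewrite (bigD1 i)//= eqxx mulr1 big1 ?addr0// => j ji.
by rewrite eq_sym (negbTE ji) mulr0.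
Qed.

End uniform_moments.

(** * Convex hull of the support *)

Section convexity.
Context {R : realType} {d : nat}.
Implicit Types (C : set 'rV[R]_d) (a b y z : 'rV[R]_d).

Definition cvx C := forall a b (s : R), 0 <= s <= 1 -> C a -> C b ->
  C (s *: a + (1 - s) *: b).

Lemma convex_set_cvx C : convex_set (C : set (convex_lmodType 'rV[R]_d)) -> cvx C.
Proof.
move=> cC a b s /andP[s0 s1] Ca Cb.
have := cC a b (Itv01 s0 s1); rewrite !inE => /(_ Ca Cb).
by [].
Qed.

Lemma cvx_average C (I : Type) (s : seq I) (h : I -> 'rV[R]_d) :
  cvx C -> (0 < size s)%N -> (forall i, C (h i)) ->
  C ((size s)%:R^-1 *: \sum_(i <- s) h i).
Proof.
move=> cC + hC; elim: s => // i s IH _ /=; rewrite big_cons.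
have [s0|s0] := posnP (size s).
  by rewrite (size0nil s0) big_nil/= invr1 scale1r addr0.
have sn0 : (size s)%:R != 0 :> R by rewrite pnatr_eq0 -lt0n.
have := cC (h i) _ ((size s).+1%:R^-1) _ (hC i) (IH s0).
rewrite invr_ge0 ler0n invf_le1 ?ltr0n// ler1n => /(_ isT).
congr C; rewrite scalerDr scalerA; congr (_ + _ *: _).
have sn1 : (size s)%:R + 1 != 0 :> R by rewrite natr1 pnatr_eq0.
by rewrite -natr1; field; rewrite sn0 sn1.
Qed.

(** The intersection of all convex supersets. Membership is used by applying it to a chosen convex
    set, so no explicit convex combinations are needed. *)
Definition hull (S : set 'rV[R]_d) : set 'rV[R]_d :=
  [set y | forall C, cvx C -> S `<=` C -> C y].

Lemma hull_cvx S : cvx (hull S).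
Proof. by move=> a b s s01 Ha Hb C cC SC; apply: (cC _ _ _ s01); [exact: Ha|exact: Hb]. Qed.

Lemma sub_hull S : S `<=` hull S.
Proof. by move=> z Sz C cC; exact. Qed.

Lemma hull_linear S (phi : 'rV[R]_d -> 'rV[R]_d) :
  (forall a b (s t : R), phi (s *: a + t *: b) = s *: phi a + t *: phi b) ->
  (forall z, S z -> S (phi z)) -> forall y, hull S y -> hull S (phi y).
Proof.
move=> lphi Sphi y Hy C cC SC; apply: (Hy (phi @^-1` C)) => [a b s s01 Ca Cb|z Sz].
  by rewrite /= lphi; exact: cC.
exact/SC/Sphi.
Qed.

Lemma flip_linear i a b (s t : R) : flip i (s *: a + t *: b) = s *: flip i a + t *: flip i b.
Proof. by apply/rowP => j; rewrite !mxE; case: ifP => // _; rewrite !mulrN opprD. Qed.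

Lemma swap_linear i k a b (s t : R) :
  swap i k (s *: a + t *: b) = s *: swap i k a + t *: swap i k b.
Proof. by apply/rowP => j; rewrite !mxE. Qed.

(** By symmetry [C] contains the cross-polytope with vertices +z_i e_k and -z_i e_k. The cube of
    half-side |z_i|/d lies inside it, as y is the average of the d axis points d y_k e_k. *)
Lemma cvx_sym_box C z i : cvx C -> (forall k y, C y -> C (flip k y)) ->
  (forall k l y, C y -> C (swap k l y)) -> C z -> z 0 i != 0 ->
  forall y, (forall k, `|y 0 k| <= `|z 0 i| / d%:R) -> C y.
Proof.
move=> cC Cflip Cswap Cz zi0.
have d0 : (0 < d)%N by apply: leq_ltn_trans (ltn_ord i).
have C1 : C (z 0 i *: delta_mx 0 i).
  (* averaging a point with its image under flip k kills the coordinate k *)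
  suff kill (s : seq 'I_d) : C (\row_k (if (k \in s) && (k != i) then 0 else z 0 k)).
    have := kill (index_enum 'I_d); congr C; apply/rowP => k.
    by rewrite !mxE mem_index_enum /=; case: (eqVneq k i) => [->|]; rewrite /= ?mulr1 ?mulr0.
  elim: s => [|k s IH].
    by move: Cz; congr C; apply/rowP => k; rewrite mxE.
  have [->|ki] := eqVneq k i.
    move: IH; congr C; apply/rowP => j; rewrite !mxE in_cons.
    by case: (eqVneq j i) => //=; rewrite andbF.
  have := cC _ _ 2^-1 _ IH (Cflip k _ IH).
  rewrite (_ : 0 <= _ <= _) => [/(_ isT)|]; last by apply/andP; split; lra.
  congr C; apply/rowP => j; rewrite !mxE in_cons.
  have [->|jk] /= := eqVneq j k; first by rewrite ki; case: ifP => _; lra.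
  by case: ifP => _; lra.
have C2 k c : `|c| <= `|z 0 i| -> C (c *: delta_mx 0 k).
  move=> cz.
  have Ck : C (z 0 i *: delta_mx 0 k).
    have := Cswap i k _ C1; congr C; apply/rowP => j; rewrite !mxE /=.
    by rewrite -[j == k](inj_eq (@perm_inj _ (tperm i k))) tpermR.
  have CNk : C (- z 0 i *: delta_mx 0 k).
    have := Cflip k _ Ck; congr C; apply/rowP => j; rewrite !mxE /=.
    by case: eqP => _; rewrite ?mulr1 ?mulr0.
  (* The weight for which the combination of z_i e_k and -z_i e_k is c e_k. *)
  have := cC _ _ ((1 + c / z 0 i) / 2) _ Ck CNk.
  have : `|c / z 0 i| <= 1.
    by rewrite normrM normfV ler_pdivrMr ?mul1r ?normr_gt0.
  rewrite ler_norml => cz1.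
  rewrite (_ : 0 <= _ <= _) => [/(_ isT)|]; last by apply/andP; split; lra.
  congr C; rewrite !scalerA -scalerDl; congr (_ *: _).
  by field.
move=> y yz.
have := @cvx_average C _ (index_enum 'I_d) (fun k => (d%:R * y 0 k) *: delta_mx 0 k) cC.
have -> : size (index_enum 'I_d) = d by rewrite -[RHS]card_ord cardT enumT.
move=> /(_ d0) Cavg.
have dn0 : d%:R != 0 :> R by rewrite pnatr_eq0 -lt0n.
suff -> : y = d%:R^-1 *: \sum_k (d%:R * y 0 k) *: delta_mx 0 k.
  apply: Cavg => k; apply: C2; rewrite normrM normr_nat.
  by have := yz k; rewrite ler_pdivlMr ?ltr0n// mulrC.
apply/rowP => j; rewrite mxE summxE (bigD1 j)//= big1 => [|k kj].
  by rewrite !mxE !eqxx mulr1 addr0 mulKf.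
by rewrite !mxE eq_sym (negbTE kj) andbF mulr0.
Qed.

Section uniform_support.
Variables (r : R) (mu : probability (borelRV R d) R).
Hypotheses (r0 : 0 < r) (umu : uniform_on_sphere r mu).

(* That the support is the whole sphere is neither proved nor needed: its
   invariance under flips and swaps already makes 0 interior to its hull. *)
Lemma hull_msupport_box :
  exists2 e : R, 0 < e & forall y, (forall k, `|y 0 k| <= e) -> hull (msupport mu) y.
Proof.
have [z [zs zr]] := ae_ex (ae_and (msupport_full mu) (uniform_sphere_ae umu)).
have [i zi] : exists i, z 0 i != 0.
  apply: contrapT => /forallNP z0; move: r0.
  rewrite -zr /norm2 /dotp big1 ?sqrtr0 ?ltxx// => i _.
  by have /negP/negPn/eqP -> := z0 i; rewrite mulr0.
have d0 : (0 < d)%N by apply: leq_ltn_trans (ltn_ord i).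
exists (`|z 0 i| / d%:R); first by rewrite divr_gt0 ?normr_gt0 ?ltr0n.
apply: (@cvx_sym_box _ z i) => //; last exact: sub_hull.
- exact: hull_cvx.
- move=> k; apply: hull_linear; first exact: flip_linear.
  by apply: msupport_involution; [exact: flip_continuous|exact: uniform_flip umu k].
- move=> k l; apply: hull_linear; first exact: swap_linear.
  by apply: msupport_involution; [exact: swap_continuous|exact: uniform_swap umu k l].
Qed.

Lemma edom_cvx (h : 'rV[R]_d -> \bar R) : closed_convex h -> cvx (edom h).
Proof.
move=> [hNy _ ch] a b s s01 ha hb; rewrite /edom /=.
apply: (le_lt_trans (ch _ _ _ s01)).
have fa : h a \is a fin_num by rewrite fin_numE hNy/= lt_eqF.
have fb : h b \is a fin_num by rewrite fin_numE hNy/= lt_eqF.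
by rewrite -(fineK fa) -(fineK fb) ltry.
Qed.

(** The point a + s z is a convex combination of a + u z and of a, which is interior to the domain
    because the hull of the support contains a cube around 0. The weight 1 - s/u of a is positive,
    so a neighbourhood of radius (u - s) e survives. *)
Lemma segment_interior_edom (h : 'rV[R]_d -> \bar R) a z (u s : R) :
  closed_convex h -> (forall z, msupport mu z -> edom h (a + u *: z)) ->
  msupport mu z -> 0 <= s < u -> (edom h)° (a + s *: z).
Proof.
move=> hh hdom zs /andP[s0 su]; have u0 : 0 < u by exact: le_lt_trans su.
have [e e0 He] := hull_msupport_box.
have hull_dom y : hull (msupport mu) y -> edom h (a + u *: y).
  move=> Hy; apply: (Hy [set y | edom h (a + u *: y)]) => // b c t t01 hb hc.
  have /= := edom_cvx hh t01 hb hc; congr edom.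
  by apply/rowP => j; rewrite !mxE; ring.
apply/nbhs_ballP; exists ((u - s) * e) => /=; first by rewrite mulr_gt0 ?subr_gt0.
move=> y [_ hy].
have us0 : u - s != 0 by rewrite subr_eq0 gt_eqF.
(* The deviation of y from a + s z is charged to the part with weight 1 - s/u, where it becomes a
   vector of the cube. *)
have -> : y = a + u *: ((s / u) *: z + (1 - s / u) *: ((u - s)^-1 *: (y - a - s *: z))).
  by apply/rowP => j; rewrite !mxE; field; rewrite us0 gt_eqF.
apply: hull_dom; apply: hull_cvx.
- by rewrite divr_ge0 ?(ltW u0)//= ler_pdivrMr// mul1r ltW.
- exact: sub_hull.
- have us : 0 < u - s by rewrite subr_gt0.
  apply: He => k; rewrite !mxE normrM normfV (gtr0_norm us) ler_pdivrMl// ltW//.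
  have := hy 0 k; rewrite -ball_normE /= !mxE distrC.
  by rewrite opprD addrA.
Qed.

End uniform_support.
End convexity.

(** * The descent lemma *)

Section descent.
Context {R : realType} {d : nat}.
Implicit Types (a z v : 'rV[R]_d) (h : 'rV[R]_d -> \bar R).

Lemma is_derive_line (f : 'rV[R]_d -> R) a z (s : R) :
  differentiable f (a + s *: z) ->
  is_derive s 1 (fun t => f (a + t *: z)) ('D_z f (a + s *: z)).
Proof.
move=> df.
have e : (fun t => t^-1 *:
           (((fun t => f (a + t *: z)) \o shift s) (t *: 1) - f (a + s *: z))) =
         (fun t => t^-1 *: ((f \o shift (a + s *: z)) (t *: z) - f (a + s *: z))).
  apply/funext => t /=; congr (_ *: (f _ - _)).
  by apply/rowP => j; rewrite !mxE [t *: 1]mulr1; ring.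
have := diff_derivable (v := z) df; rewrite /derivable -e => cv.
by split => //; rewrite /derive -e.
Qed.

Lemma derive_grad h a z : differentiable (fun b => fine (h b)) a ->
  'D_z (fun b => fine (h b)) a = dotp (grad h a) z.
Proof.
move=> df; rewrite deriveE// [in LHS](row_sum_delta z) linear_sum /=.
by apply: eq_bigr => i _; rewrite linearZ /= mxE deriveE// mulrC.
Qed.

Lemma is_derive_quad (c q s : R) :
  is_derive s 1 (fun t => t * c + t ^+ 2 * q) (c + s * (2 * q)).
Proof.
apply: is_derive_eq.
rewrite /GRing.scale /=. ring.
Qed.


Lemma line_continuous a z : continuous (fun t : R => a + t *: z).
Proof. by move=> t; apply: cvgD; [exact: cvg_cst|exact: scalel_continuous]. Qed.

Lemma closed_convex_fin h a : closed_convex h -> edom h a -> h a \is a fin_num.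
Proof. by move=> [hNy _ _] ha; rewrite fin_numE hNy/= lt_eqF. Qed.

(** By the subgradient inequality, h(a + t z) - t <v, z> is minimal at t = 0, an interior point, so
    its derivative vanishes there. *)
Lemma subdifferential_dotp h l a z v : closed_convex h -> lipschitz_gradient h l ->
  (edom h)° a -> subdifferential h a v -> dotp v z = dotp (grad h a) z.
Proof.
move=> ch [dh _] a0 va.
have : nbhs (0 : R) [set t | (edom h)° (a + t *: z)].
  apply: (@line_continuous a z 0); rewrite scale0r addr0.
  by apply: open_nbhs_nbhs; split => //; exact: open_interior.
move=> /nbhs_ballP[e /= e0 He].
have dom t : t \in `]- e, e[ -> (edom h)° (a + t *: z).
  by rewrite in_itv/= -ltr_norml => te; apply: He; rewrite -ball_normE /= sub0r normrN.
have fin t : t \in `]- e, e[ -> h (a + t *: z) \is a fin_num.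
  by move=> te; apply: closed_convex_fin => //; apply: interior_subset; exact: dom.
have z0 : 0 \in `]- e, e[ by rewrite in_itv/= oppr_lt0 e0.
(* The null quadratic term gives [g] the shape that [is_derive_quad] differentiates. *)
pose g t := fine (h (a + t *: z)) - (t * dotp v z + t ^+ 2 * 0).
have dg t : t \in `]- e, e[ ->
    is_derive t 1 g (dotp (grad h (a + t *: z)) z - (dotp v z + t * (2 * 0))).
  move=> te; rewrite -derive_grad; last exact/dh/dom.
  have := is_derive_line (dh _ (dom _ te)) => d1.
  have := is_derive_quad (dotp v z) 0 t => d2.
  exact: is_deriveB.
have : is_derive (0 : R) (1 : R) g 0.
  apply: (@derive1_at_min _ g (- e) e) => //; first by lra.
    by move=> t /dg[].
  move=> t te; have := va (a + t *: z).
  rewrite /g scale0r addr0 mul0r expr0n /= mul0r addr0 subr0 mulr0 addr0.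
  have := fin _ te; have := fin _ z0; rewrite scale0r addr0.
  move=> /fineK <- /fineK <-; rewrite [_ - a]addrC addKr -EFinD lee_fin dotpZr /=.
  lra.
move=> [_]; case: (dg _ z0) => _ ->; rewrite scale0r addr0; lra.
Qed.

(** Subtracting the quadratic model from h(a + t z) leaves the derivative <grad h(a + t z) - grad
    h(a), z> - t l |z|^2, which is nonpositive by Cauchy-Schwarz and the Lipschitz bound. *)
Lemma descent_open h l a z v (u : R) : closed_convex h -> lipschitz_gradient h l ->
  (forall s, 0 <= s < u -> (edom h)° (a + s *: z)) -> subdifferential h a v ->
  forall s, 0 <= s < u ->
    (h (a + s *: z)%R <= h a + (s * dotp v z + s ^+ 2 * (l * norm2 z ^+ 2 / 2))%:E)%E.
Proof.
move=> ch lg dom va s /andP[s0 su]; have [dh gl] := lg.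
have u0 : (0 : R) <= 0 < u by rewrite lexx (le_lt_trans s0).
have a0 : (edom h)° a by have := dom _ u0; rewrite scale0r addr0.
have fin t : 0 <= t < u -> h (a + t *: z) \is a fin_num.
  by move=> te; apply: closed_convex_fin => //; apply: interior_subset; exact: dom.
set q := l * norm2 z ^+ 2 / 2.
pose g t := fine (h (a + t *: z)) - (t * dotp v z + t ^+ 2 * q).
have dg t : 0 <= t < u ->
    is_derive t 1 g (dotp (grad h (a + t *: z)) z - (dotp v z + t * (2 * q))).
  move=> te; rewrite -derive_grad; last exact/dh/dom.
  have := is_derive_line (dh _ (dom _ te)) => d1.
  have := is_derive_quad (dotp v z) q t => d2.
  exact: is_deriveB.
have itv t : t \in `[0, s] -> 0 <= t < u.
  by rewrite in_itv/= => /andP[-> ts]; exact: le_lt_trans su.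
have itvo t : t \in `]0, s[ -> 0 <= t < u.
  by rewrite in_itv/= => /andP[/ltW-> ts]; exact: lt_trans su.
have : g s <= g 0.
  apply: (@ler0_derive1_le_cc _ g 0 s).
  - by move=> t /itvo/dg[].
  - move=> t /itvo tu.
    rewrite derive1E; case: (dg _ tu) => _ ->.
    rewrite (subdifferential_dotp z ch lg a0 va) opprD addrA -dotpNl -dotpDl.
    rewrite subr_le0 (le_trans (ler_norm _))// (le_trans (dotp_CS _ _))//.
    have := gl _ _ (dom _ tu) a0; rewrite [_ - a]addrC addKr norm2Z.
    move=> /(ler_wpM2r (norm2_ge0 z)) /le_trans; apply.
    rewrite ger0_norm ?(andP tu).1// /q.
    by rewrite [leRHS](_ : _ = l * (t * norm2 z) * norm2 z)//; field.
  - by apply: derivable_within_continuous => t /itv/dg[].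
  - by rewrite in_itv/= s0 lexx.
  - by rewrite in_itv/= lexx s0.
  - exact: s0.
rewrite /g scale0r addr0 mul0r expr0n /= mul0r addr0 subr0.
have := fin _ u0; have := fin s; rewrite s0 su scale0r addr0 => /(_ isT).
move=> /fineK <- /fineK <-; rewrite -EFinD lee_fin /=; lra.
Qed.

(** The number [e] is the bias of the difference quotient: the subgradient inequality makes it
    nonnegative, the quadratic upper bound makes it of order u. *)
Lemma descent h l a z v (u : R) : 0 < u -> closed_convex h -> lipschitz_gradient h l ->
  (forall s, 0 <= s < u -> (edom h)° (a + s *: z)) -> subdifferential h a v ->
  exists2 e, 0 <= e <= u * (l * norm2 z ^+ 2 / 2) &
    fine (h (a + u *: z)) - fine (h a) = u * (dotp v z + e).
Proof.
move=> u0 ch lg dom va.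
have fa : h a \is a fin_num.
  apply: closed_convex_fin => //; apply: interior_subset.
  by have := dom 0; rewrite lexx u0 scale0r addr0; apply.
(* a + u z may lie on the boundary of the domain, where only the closedness of
   the epigraph gives the bound *)
have ub : (h (a + u *: z)%R <=
    (fine (h a) + (u * dotp v z + u ^+ 2 * (l * norm2 z ^+ 2 / 2)))%:E)%E.
  have [_ cl _] := ch.
  pose r s := fine (h a) + (s * dotp v z + s ^+ 2 * (l * norm2 z ^+ 2 / 2)).
  have PF := at_left_proper_filter u.
  have Fu : Filter (u^'-) := PF.
  suff [near_epi cvg_epi] : (\forall s \near u^'-, (h (a + s *: z)%R <= (r s)%:E)%E) /\
      ((a + s *: z, r s) @[s --> u^'-] --> (a + u *: z, r u)).
    exact: (@closed_cvg _ _ _ PF (fun s => (a + s *: z, r s)) _ cl near_epi _ cvg_epi).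
  split.
    near=> s; rewrite /= /r EFinD fineK//.
    by apply: (descent_open ch lg dom va); apply/andP; split; near: s;
      [exact: nbhs_left_ge|exact: nbhs_left_lt].
  apply: (cvg_pair (FG := nbhs_filter _) (FH := nbhs_filter _)) => /=.
    by apply: cvg_at_left_filter; exact: line_continuous.
  apply: cvg_at_left_filter; apply: cvgD; first exact: cvg_cst.
  have [d1 _] := is_derive_quad (dotp v z) (l * norm2 z ^+ 2 / 2) u.
  by move/derivable1_diffP/differentiable_continuous : d1; exact.
have fb : h (a + u *: z) \is a fin_num.
  by apply: closed_convex_fin => //; apply: le_lt_trans ub _; exact: ltry.
have lb := va (a + u *: z).
move: lb ub; rewrite [_ - a]addrC addKr dotpZr.
rewrite -(fineK fa) -(fineK fb) -EFinD !lee_fin /= => lb ub.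
exists ((fine (h (a + u *: z)) - fine (h a)) / u - dotp v z); last first.
  by field; rewrite gt_eqF.
rewrite subr_ge0 ler_pdivlMr// lerBlDr ler_pdivrMr//.
by apply/andP; split; lra.
Unshelve. all: by end_near. Qed.

End descent.

(** * The two-point gradient estimate *)

Section domination.
Context {dT : measure_display} {T : measurableType dT} {R : realType}.
Variable mu : probability T R.

Lemma integral_ae_le_mean (h : T -> \bar R) (h2 : T -> R) m :
  measurable_fun setT h -> (forall x, 0 <= h x)%E ->
  has_mean mu h2 m -> {ae mu, forall x, (h x <= (h2 x)%:E)%E} ->
  (\int[mu]_x h x <= m%:E)%E.
Proof.
move=> mh h0 h2m hh2; have mh2 : measurable_fun setT (EFin \o h2).
  exact/measurable_EFinP/(has_mean_measurable h2m).
rewrite -(proj2 h2m) (_ : (\int[mu]_x _%:E = \int[mu]_x `|(h2 x)%:E|)%E).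
  apply: ae_ge0_le_integral => //; first exact: measurableT_comp.
  by apply: ae_mono hh2 => x hx _; rewrite (le_trans hx)// lee_fin ler_norm.
apply: ae_eq_integral => //; first exact: measurableT_comp.
by apply: ae_mono hh2 => x hx _; rewrite gee0_abs// (le_trans (h0 x)).
Qed.

Lemma has_mean_dominated (h h2 : T -> R) m : measurable_fun setT h ->
  has_mean mu h2 m -> (forall x, `|h x| <= h2 x) -> exists m', has_mean mu h m'.
Proof.
move=> mh h2m hh2; have mEh : measurable_fun setT (EFin \o h) by exact/measurable_EFinP.
have ih : mu.-integrable setT (EFin \o h).
  apply: (le_integrable measurableT mEh _ (proj1 h2m)) => x _.
  by rewrite lee_fin (le_trans (hh2 x))// ler_norm.
exists (fine (\int[mu]_x (h x)%:E)); split => //.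
by rewrite fineK//; exact: integrable_fin_num.
Qed.

End domination.

Section one_step.
Context {R : realType} {d : nat} {dX : measure_display} {XX : measurableType dX}.
Variables (P : probability XX R) (mu : probability (borelRV R d) R).
Variable F : 'rV[R]_d -> XX -> \bar R.
Hypothesis mF : measurable_fun setT (fun p : borelRV R d * XX => F p.1 p.2).

(** This measures the step before projection; the projection enters separately, through
    [proj_contract]. *)
Definition sq_error (ts : 'rV[R]_d) (al v : R) (a z : 'rV[R]_d) (x : XX) : R :=
  norm2 (a - al *: grad_estimate F v a z x - ts) ^+ 2.

Lemma grad_estimate_measurable (v : R) : measurable_fun setT
  (fun p : borelRV R d * (XX * borelRV R d) =>
     grad_estimate F v p.1 p.2.2 p.2.1 : borelRV R d).
Proof.
have m1 i : measurable_fun setT (fun p : borelRV R d * (XX * borelRV R d) => p.1 0 i).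
  exact: (measurableT_comp (measurable_coord i) measurable_fst).
have m2 i : measurable_fun setT (fun p : borelRV R d * (XX * borelRV R d) => p.2.2 0 i).
  apply: (measurableT_comp (measurable_coord i)).
  exact: (measurableT_comp measurable_snd measurable_snd).
have mFc (h : borelRV R d * (XX * borelRV R d) -> borelRV R d) : measurable_fun setT h ->
    measurable_fun setT (fun p : borelRV R d * (XX * borelRV R d) => fine (F (h p) p.2.1)).
  move=> mh; apply: measurableT_comp; first exact: fine_measurable.
  exact: (measurableT_comp mF (measurable_fun_pair mh
    (measurableT_comp measurable_fst measurable_snd))).
apply: rV_measurable => i.
rewrite (_ : (fun p => _) = fun p : borelRV R d * (XX * borelRV R d) =>
  (fine (F (p.1 + v *: p.2.2) p.2.1) - fine (F p.1 p.2.1)) / v * p.2.2 0 i); last first.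
  by apply/funext => p; rewrite mxE.
apply: measurable_funM => //; apply: measurable_funM => //; apply: measurable_funB.
  apply: mFc; apply: rV_measurable => j.
  rewrite (_ : (fun p => _) = fun p : borelRV R d * (XX * borelRV R d) =>
    p.1 0 j + v * p.2.2 0 j); last by apply/funext => p; rewrite !mxE.
  by apply: measurable_funD => //; exact: measurable_funM.
by apply: mFc; exact: measurable_fst.
Qed.

Lemma sq_error_measurable ts al v : measurable_fun setT
  (fun p : borelRV R d * (XX * borelRV R d) => sq_error ts al v p.1 p.2.2 p.2.1).
Proof.
apply: measurable_funX.
suff mw : measurable_fun setT (fun p : borelRV R d * (XX * borelRV R d) =>
    p.1 - al *: grad_estimate F v p.1 p.2.2 p.2.1 - ts : borelRV R d).
  exact: (measurableT_comp (@norm2_borel R d) mw).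
apply: rV_measurable => j.
rewrite (_ : (fun p => _) = fun p : borelRV R d * (XX * borelRV R d) =>
  p.1 0 j - al * grad_estimate F v p.1 p.2.2 p.2.1 0 j - ts 0 j); last first.
  by apply/funext => p; rewrite !mxE.
apply: measurable_funB => //; apply: measurable_funB.
  exact: (measurableT_comp (measurable_coord j) measurable_fst).
apply: measurable_funM => //.
exact: (measurableT_comp (measurable_coord j) (grad_estimate_measurable v)).
Qed.

(** Expand the square. The bias in the cross term is bounded by Cauchy-Schwarz, and (B + e)^2 <= 2
    B^2 + 2 b^2 splits the second moment. What still depends on z is a sum of products of two inner
    products, which [uniform_dotp2] integrates. *)
Lemma sq_error_le (w z v : 'rV[R]_d) (al e b rad : R) :
  0 <= al -> 0 <= e <= b -> norm2 w <= rad -> norm2 z = Num.sqrt d%:R ->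
  norm2 (w - al *: ((dotp v z + e) *: z)) ^+ 2 <=
  (dotp w w + 2 * al * (b * (Num.sqrt d%:R * rad)) + 2 * al ^+ 2 * d%:R * b ^+ 2) -
  2 * al * (dotp v z * dotp z w) + 2 * al ^+ 2 * d%:R * (dotp v z * dotp z v).
Proof.
move=> al0 /andP[e0 eb] wr zd.
have zz : dotp z z = d%:R by rewrite -sqr_norm2 zd sqr_sqrtr.
rewrite sqr_norm2 dotp_sqrB !(dotpZl, dotpZr) zz (dotpC w z) (dotpC z v).
set B := dotp v z; set c := dotp z w; set s := Num.sqrt d%:R.
have d0 : 0 <= d%:R :> R by [].
have cs : - c <= s * rad.
  rewrite lerNl -lerN2 opprK; apply: le_trans (_ : `|c| <= _).
    by rewrite -normrN ler_norm.
  by rewrite (le_trans (dotp_CS _ _))// zd ler_wpM2l// sqrtr_ge0.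
have srad : 0 <= s * rad.
  by rewrite mulr_ge0 ?sqrtr_ge0// (le_trans (norm2_ge0 w)).
have h1 : - (e * c) <= b * (s * rad).
  rewrite -mulrN (le_trans (ler_wpM2l e0 cs))//; exact: ler_wpM2r.
have h2 : (B + e) ^+ 2 <= 2 * B ^+ 2 + 2 * b ^+ 2.
  have := sqr_ge0 (B - e); have : e ^+ 2 <= b ^+ 2 by rewrite lerXn2r ?nnegrE// (le_trans e0).
  by rewrite !expr2; lra.
have h3 := ler_wpM2l al0 h1.
have h4 : al ^+ 2 * d%:R * (B + e) ^+ 2 <= al ^+ 2 * d%:R * (2 * B ^+ 2 + 2 * b ^+ 2).
  by apply: ler_wpM2l => //; rewrite mulr_ge0// sqr_ge0.
rewrite !expr2 in h3 h4 *; lra.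
Qed.

(** The bias is linear in [L], while the assumption controls its second moment. *)
Lemma has_mean_Lipschitz (L : XX -> R) (l : R) : measurable_fun setT L ->
  (forall x, 0 <= L x) -> 0 < l -> has_mean P (fun x => L x ^+ 2) (l ^+ 2) ->
  exists2 m, has_mean P L m & m <= l.
Proof.
move=> mL L0 l0 hL2.
have hd := has_meanZ (1 / 2) (has_meanD (has_meanZ l^-1 hL2) (has_mean_cst P l)).
(* AM-GM *)
have le_d x : L x <= 1 / 2 * (l^-1 * L x ^+ 2 + l).
  have := sqr_ge0 (L x - l) => h.
  have : 0 <= l^-1 * (L x - l) ^+ 2 by rewrite mulr_ge0// invr_ge0 ltW.
  rewrite (_ : l^-1 * (L x - l) ^+ 2 = l^-1 * L x ^+ 2 + l - 2 * L x); first lra.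
  by field; rewrite gt_eqF.
have [m hm] := has_mean_dominated mL hd (fun x => ltac:(rewrite ger0_norm//; exact: le_d)).
exists m => //; have := has_mean_ae_le hm hd (aeW _ le_d).
by rewrite (_ : 1 / 2 * _ = l)//; field; rewrite gt_eqF.
Qed.

(** Since |g_i| <= |g|^2 + 1, the coordinates are integrable, and [fine] in [mean_vec] hides no
    infinite value. *)
Lemma mean_vec_dotp (g : XX -> 'rV[R]_d) (G2 : R) (w : 'rV[R]_d) :
  measurable_fun setT (g : XX -> borelRV R d) ->
  has_mean P (fun x => norm2 (g x) ^+ 2) G2 ->
  has_mean P (fun x => dotp (g x) w) (dotp (mean_vec P g) w).
Proof.
move=> mg hg.
have hi i : has_mean P (fun x => g x 0 i) (mean_vec P g 0 i).
  have mgi : measurable_fun setT (fun x => g x 0 i).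
    exact: (measurableT_comp (measurable_coord i) mg).
  have [x|m hm] := has_mean_dominated mgi (has_meanD hg (has_mean_cst P 1)).
    rewrite (le_trans (ler_coord_norm2 _ _))//.
    have := sqr_ge0 (norm2 (g x) - 1); rewrite !expr2.
    have := sqr_ge0 (norm2 (g x)); rewrite !expr2; lra.
  by rewrite mxE; case: (hm) => _ ->.
apply: has_mean_sum => i _.
have := has_meanZ (w 0 i) (hi i).
by congr has_mean; [apply/funext => x|]; rewrite mulrC.
Qed.

Hypotheses (d0 : (0 < d)%N) (umu : uniform_on_sphere (Num.sqrt d%:R) mu).
Variables (L : XX -> R) (LP G rad : R).
Hypotheses (mL : measurable_fun setT L) (L0 : forall x, 0 <= L x) (LP0 : 0 < LP)
  (hL2 : has_mean P (fun x => L x ^+ 2) (LP ^+ 2)).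
Hypothesis Fcvx : {ae P, forall x, closed_convex (F^~ x)}.
Hypothesis Flip : {ae P, forall x, lipschitz_gradient (F^~ x) (L x)}.

(** [sq_error_le] is integrated over z, then over x. The domain is controlled at the radius [u],
    which may exceed the smoothing radius [v] of the step. *)
Lemma one_step_bound (g : XX -> 'rV[R]_d) (a ts : 'rV[R]_d) (al v u : R) :
  0 <= al -> 0 < v <= u -> norm2 (a - ts) <= rad ->
  (forall x z, msupport mu z -> edom (F^~ x) (a + u *: z)) ->
  measurable_fun setT (g : XX -> borelRV R d) ->
  {ae P, forall x, subdifferential (F^~ x) a (g x)} ->
  (\int[P]_x (norm2 (g x) ^+ 2)%:E <= (G ^+ 2)%:E)%E ->
  (\int[P]_x \int[mu]_z (sq_error ts al v a z x)%:E <=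
    (norm2 (a - ts) ^+ 2 - 2 * al * dotp (mean_vec P g) (a - ts)
     + al * v * LP * (d%:R * Num.sqrt d%:R * rad)
     + al ^+ 2 * (2 * d%:R * G ^+ 2 + d%:R ^+ 3 * v ^+ 2 * LP ^+ 2 / 2))%:E)%E.
Proof.
move=> al0 /andP[v0 vu] war dom mg sub gG; set w := a - ts; set s := Num.sqrt d%:R.
have m_xz : measurable_fun setT (fun p : XX * borelRV R d => (sq_error ts al v a p.2 p.1)%:E).
  apply/measurable_EFinP.
  exact: (measurableT_comp (sq_error_measurable ts al v)
    (measurable_fun_pair (measurable_cst (a : borelRV R d)) (@measurable_id _ _ setT))).
have sq_ge0 x z : (0 <= (sq_error ts al v a z x)%:E)%E by rewrite lee_fin sqr_ge0.
have [G2 hG2 /andP[G20 G2G]] := has_mean_ge0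
  (measurable_funX 2 (measurableT_comp (@norm2_borel R d) mg)) (fun x => sqr_ge0 _) gG.
have hgw := mean_vec_dotp w mg hG2.
have [mLP hLP mLPle] := has_mean_Lipschitz mL L0 LP0 hL2.
(* The bound v L(x) |z|^2 / 2 of [descent], with |z|^2 = d. Hence 2 d b^2 = d^3 v^2 L(x)^2 / 2. *)
pose b x := v * L x * d%:R / 2.
pose B x := (dotp w w + 2 * al * (b x * (s * rad)) + 2 * al ^+ 2 * d%:R * b x ^+ 2)
  - 2 * al * dotp (g x) w + 2 * al ^+ 2 * d%:R * norm2 (g x) ^+ 2.
have hB : has_mean P B (dotp w w + al * v * d%:R * s * rad * mLP
   + al ^+ 2 * d%:R ^+ 3 * v ^+ 2 / 2 * LP ^+ 2
   - 2 * al * dotp (mean_vec P g) w + 2 * al ^+ 2 * d%:R * G2).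
  apply: has_meanD; last exact: has_meanZ.
  apply: has_meanB; last exact: has_meanZ.
  have := has_meanD (has_meanD (has_mean_cst P (dotp w w))
    (has_meanZ (al * v * d%:R * s * rad) hLP))
    (has_meanZ (al ^+ 2 * d%:R ^+ 3 * v ^+ 2 / 2) hL2).
  by congr has_mean; apply/funext => x; rewrite /b; field.
apply: (@le_trans _ _ (dotp w w + al * v * d%:R * s * rad * mLP
   + al ^+ 2 * d%:R ^+ 3 * v ^+ 2 / 2 * LP ^+ 2
   - 2 * al * dotp (mean_vec P g) w + 2 * al ^+ 2 * d%:R * G2)%:E); last first.
  rewrite lee_fin sqr_norm2 -/w.
  have rad0 : 0 <= rad by rewrite (le_trans (norm2_ge0 (a - ts))).
  have h1 : al * v * d%:R * s * rad * mLP <= al * v * d%:R * s * rad * LP.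
    by apply: ler_wpM2l => //; rewrite !mulr_ge0// ?sqrtr_ge0// ltW.
  have h2 : 2 * al ^+ 2 * d%:R * G2 <= 2 * al ^+ 2 * d%:R * G ^+ 2.
    by apply: ler_wpM2l => //; rewrite !mulr_ge0// sqr_ge0.
  rewrite -subr_ge0; move: h1 h2; rewrite -subr_ge0 => h1; rewrite -subr_ge0 => h2.
  by move: (addr_ge0 h1 h2); congr (0 <= _); field.
apply: (integral_ae_le_mean _ _ hB).
- exact: (measurable_fun_fubini_tonelli_F (m2 := mu) _ m_xz (fun p => sq_ge0 p.1 p.2)).
- by move=> x; apply: integral_ge0 => z _; exact: sq_ge0.
apply: ae_mono (ae_and (ae_and Fcvx Flip) sub) => x [[cF lF] sx].
have hz : has_mean mu (fun z : borelRV R d =>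
    (dotp w w + 2 * al * (b x * (s * rad)) + 2 * al ^+ 2 * d%:R * b x ^+ 2) -
    2 * al * (dotp (g x) z * dotp z w) +
    2 * al ^+ 2 * d%:R * (dotp (g x) z * dotp z (g x))) (B x).
  rewrite /B sqr_norm2; apply: has_meanD; last exact/has_meanZ/uniform_dotp2.
  by apply: has_meanB; [exact: has_mean_cst|exact/has_meanZ/uniform_dotp2].
apply: (integral_ae_le_mean _ _ hz) => //.
  exact: (measurableT_comp m_xz
    (measurable_fun_pair (measurable_cst x) (@measurable_id _ _ setT))).
apply: ae_mono (ae_and (msupport_full mu) (uniform_sphere_ae umu)) => z [zs zd].
have s0 : 0 < s by rewrite sqrtr_gt0 ltr0n.
have [e eb ve] := descent v0 cF lF (fun t => ltac:(move=> /andP[t0 tv];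
  apply: (@segment_interior_edom R d s mu s0 umu _ a z u t cF (dom x) zs);
  rewrite t0; exact: lt_le_trans vu)) sx.
rewrite lee_fin /sq_error /grad_estimate ve.
rewrite (_ : a - _ - ts = w - al *: ((dotp (g x) z + e) *: z)); last first.
  rewrite (mulrC v) mulfK ?gt_eqF// /w addrAC //.
apply: sq_error_le => //.
move: eb; rewrite zd sqr_sqrtr// /b (_ : v * (_ / 2) = v * L x * d%:R / 2)//.
by field.
Qed.

End one_step.

(** * Independence of the iterates from the current sample *)

Lemma eq_measure_prod (d1 d2 : measure_display) (T1 : measurableType d1)
    (T2 : measurableType d2) (R : realType) (m m' : measure (T1 * T2)%type R) :
  (m setT < +oo)%E ->
  (forall A B, measurable A -> measurable B -> m (A `*` B) = m' (A `*` B)) ->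
  forall S, measurable S -> m S = m' S.
Proof.
move=> moo mE; apply: (measure_unique [set A `*` B | A in measurable & B in measurable]
  (fun=> setT)) => //.
- exact: measurable_prod_measurableType.
- move=> _ _ [A mA [B mB <-]] [A' mA' [B' mB' <-]]; rewrite -setXI.
  by exists (A `&` A'); [exact: measurableI|exists (B `&` B') => //; exact: measurableI].
- by move=> i; exists setT => //; exists setT => //; rewrite setXTT.
- by rewrite bigcup_const//; exists 0%N.
- by move=> _ [A mA [B mB <-]]; exact: mE.
Qed.

Section triple.
Context {dO d1 d2 d3 : measure_display} {Omega : measurableType dO}
  {T1 : measurableType d1} {T2 : measurableType d2} {T3 : measurableType d3} {R : realType}.

(** The two-factor case is used twice. For a fixed first side A, the measure of A times a set is a
    measure in that set: the image under [snd] of a restriction. *)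
Lemma eq_measure_prod3 (m m' : measure (T1 * (T2 * T3))%type R) :
  (m setT < +oo)%E ->
  (forall A B C, measurable A -> measurable B -> measurable C ->
     m (A `*` (B `*` C)) = m' (A `*` (B `*` C))) ->
  forall S, measurable S -> m S = m' S.
Proof.
move=> moo mE; apply: eq_measure_prod => // A S mA mS.
have mAT : measurable (A `*` [set: T2 * T3]) by exact: measurableX.
have sndE (n : measure (T1 * (T2 * T3))%type R) S' :
    pushforward (mrestr n mAT) snd S' = n (A `*` S').
  by rewrite /pushforward /mrestr; congr (n _); apply/seteqP; split=> -[x y] /=; tauto.
have msnd : measurable_fun setT (@snd T1 (T2 * T3)) by exact: measurable_snd.
pose mm (n : measure (T1 * (T2 * T3))%type R) : measure (T2 * T3)%type R :=
  pushforward (mrestr n mAT) snd.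
rewrite -!sndE.
have /(_ _ _ S mS) := @eq_measure_prod _ _ _ _ _ (mm msnd m) (mm msnd m'); apply.
  rewrite [mm _ m _]sndE; apply: le_lt_trans moo.
  by apply: le_measure; rewrite ?inE.
by move=> B C mB mC; rewrite [mm _ m _]sndE [mm _ m' _]sndE; exact: mE.
Qed.

Variables (Pr : probability Omega R) (P : probability T2 R) (mu : probability T3 R).
Variables (V : Omega -> T1) (W : Omega -> T2) (Y : Omega -> T3).
Hypotheses (mV : measurable_fun setT V) (mW : measurable_fun setT W)
  (mY : measurable_fun setT Y).

Let U w := (V w, (W w, Y w)).

Let mU : measurable_fun setT U.
Proof. by apply: measurable_fun_pair => //; exact: measurable_fun_pair. Qed.

(** Both sides are finite measures in [S], so independence of [K] from boxes extends to all
    measurable sets of the product. *)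
Lemma independent_event (K : set Omega) (k : \bar R) : measurable K ->
  (forall A B C, measurable A -> measurable B -> measurable C ->
    Pr (V @^-1` A `&` (W @^-1` B `&` Y @^-1` C)) = (Pr (V @^-1` A) * (P B * mu C))%E) ->
  (forall A B C, measurable A -> measurable B -> measurable C ->
    Pr (V @^-1` A `&` (W @^-1` B `&` Y @^-1` C) `&` K) =
    (Pr (V @^-1` A) * (P B * mu C) * k)%E) ->
  forall S, measurable S -> Pr (U @^-1` S `&` K) = (Pr (U @^-1` S) * k)%E.
Proof.
move=> mK ind indK S mS.
(* Taking the whole spaces for A, B and C identifies k, which is therefore finite and nonnegative
   and can serve as a scaling factor. *)
have kE : k = Pr K.
  have := indK setT setT setT measurableT measurableT measurableT.
  by rewrite !preimage_setT !setTI !probability_setT !mul1e.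
have k0 : (0 <= fine k)%R by rewrite kE fine_ge0.
have fk : k = (fine k)%:E by rewrite fineK// kE fin_num_measure.
pose m1 : measure (T1 * (T2 * T3))%type R := pushforward (mrestr Pr mK) U.
pose m2 : measure (T1 * (T2 * T3))%type R := mscale (NngNum k0) (pushforward Pr U).
have -> : Pr (U @^-1` S `&` K) = m1 mU S by [].
have -> : (Pr (U @^-1` S) * k)%E = m2 mU S by rewrite muleC fk.
apply: eq_measure_prod3 => //.
  rewrite /m1 /= /pushforward /mrestr preimage_setT setTI.
  by rewrite (le_lt_trans (probability_le1 Pr mK))// ltry.
move=> A B C mA mB mC; apply: (etrans (indK _ _ _ mA mB mC)).
by rewrite -ind// muleC fk.
Qed.

(** The joint law agrees on boxes with the product of the law of [V], [P] and [mu], hence equals it;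
    Tonelli's theorem then freezes [V]. *)
Lemma ge0_integral_freeze (h : T1 * (T2 * T3) -> \bar R) :
  measurable_fun setT h -> (forall p, 0 <= h p)%E ->
  (forall A B C, measurable A -> measurable B -> measurable C ->
    Pr (V @^-1` A `&` (W @^-1` B `&` Y @^-1` C)) = (Pr (V @^-1` A) * (P B * mu C))%E) ->
  (\int[Pr]_w h (U w) = \int[Pr]_w \int[P]_x \int[mu]_z h (V w, (x, z)))%E.
Proof.
move=> mh h0 ind.
pose V' : {mfun Omega >-> T1} := HB.pack V (isMeasurableFun.Build _ _ _ _ V mV).
pose U' : {mfun Omega >-> (T1 * (T2 * T3))%type} :=
  HB.pack U (isMeasurableFun.Build _ _ _ _ U mU).
have := ge0_integral_distribution (P := Pr) U' mh h0 => <-.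
pose Q : probability (T2 * T3)%type R := product_measure1 P mu.
pose VQ : probability (T1 * (T2 * T3))%type R := product_measure1 (distribution Pr V') Q.
have lawU S : measurable S -> S `<=` setT -> distribution Pr U' S = VQ S.
  move=> mS _; apply: (@eq_measure_prod3 (distribution Pr U') VQ) => //.
    by rewrite /= probability_setT ltry.
  move=> A B C mA mB mC; apply: (etrans (ind A B C mA mB mC)).
  have <- : Q (B `*` C) = (P B * mu C)%E by exact: product_measure1E.
  by apply/esym; apply: product_measure1E => //; exact: measurableX.
rewrite (eq_measure_integral VQ lawU) fubini_tonelli1//.
rewrite (ge0_integral_distribution V')//=.
- apply: eq_integral => w _; rewrite /fubini_F /= fubini_tonelli1//.
  exact: (measurableT_comp mh
    (measurable_fun_pair (measurable_cst _) (@measurable_id _ _ setT))).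
- exact: measurable_fun_fubini_tonelli_F.
- by move=> v; exact: integral_ge0.
Qed.

End triple.

Section recursion.
Context {dO dS dX dZ : measure_display} {Omega : measurableType dO}
  {S : measurableType dS} {TX : measurableType dX} {TZ : measurableType dZ} {R : realType}.
Variables (Pr : probability Omega R) (P : probability TX R) (mu : probability TZ R).
Variables (X : nat -> Omega -> TX) (Z : nat -> Omega -> TZ).
Hypotheses (iidX : iid Pr P X) (iidZ : iid Pr mu Z)
  (indXZ : independent_sequences Pr X Z).
Variables (s0 : S) (Phi : nat -> S * (TX * TZ) -> S) (Y : nat -> Omega -> S).
Hypotheses (mPhi : forall t, measurable_fun setT (Phi t))
  (Y0 : forall w, Y 0%N w = s0)
  (YS : forall t w, Y t.+1 w = Phi t (Y t w, (X t w, Z t w))).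

Let mX t : measurable_fun setT (X t). Proof. by case: iidX. Qed.
Let mZ t : measurable_fun setT (Z t). Proof. by case: iidZ. Qed.

Lemma recursion_measurable t : measurable_fun setT (Y t).
Proof.
elim: t => [|t IH]; first by rewrite (_ : Y 0%N = cst s0)//; exact/funext.
rewrite (_ : Y t.+1 = Phi t \o (fun w => (Y t w, (X t w, Z t w)))).
  apply: measurableT_comp => //.
  by apply: measurable_fun_pair => //; exact: measurable_fun_pair.
by apply/funext => w; exact: YS.
Qed.

Let future (A : nat -> set TX) (B : nat -> set TZ) t n : set Omega :=
  \bigcap_(j in [set j | (t <= j < n)%N]) (X j @^-1` A j `&` Z j @^-1` B j).

Let measurable_future A B t n : (forall j, measurable (A j)) ->
  (forall j, measurable (B j)) -> measurable (future A B t n).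
Proof.
move=> mA mB; apply: bigcap_measurableType => j _; apply: measurableI.
  by rewrite -[X in measurable X]setTI; exact: mX.
by rewrite -[X in measurable X]setTI; exact: mZ.
Qed.

Let Pr_bigcap (d' : measure_display) (T : measurableType d') (Q : probability T R)
    (W : nat -> Omega -> T) (A : nat -> set T) n : iid Pr Q W ->
  (forall j, measurable (A j)) ->
  Pr (\bigcap_(j in [set j | (j < n)%N]) (W j @^-1` A j)) = (\prod_(0 <= j < n) Q (A j))%E.
Proof.
move=> [mW lawW indW] mA.
pose J : {fset nat} := [fset j in iota 0 n]%fset.
have JE : [set` J] = [set j | (j < n)%N].
  by apply/seteqP; split=> j /=; rewrite in_fset /= mem_iota add0n.
rewrite -JE indW//.
rewrite (perm_big (index_iota 0 n)) /=; last first.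
  apply: uniq_perm; rewrite ?fset_uniq ?iota_uniq// => j.
  by rewrite in_fset mem_iota mem_index_iota.
by apply: eq_bigr => j _; exact: lawW.
Qed.

Let sigma_of_bigcap (d' : measure_display) (T : measurableType d')
    (W : nat -> Omega -> T) (A : nat -> set T) n :
  (forall j, measurable (A j)) ->
  sigma_of W (\bigcap_(j in [set j | (j < n)%N]) (W j @^-1` A j)).
Proof.
move=> mA.
apply: (@bigcap_measurableType _ (g_sigma_algebraType
  [set E | exists j (A : set T), measurable A /\ E = W j @^-1` A])) => j _.
by apply: sub_sigma_algebra; exists j, (A j).
Qed.

(* The future cylinder events make the statement strong enough for induction:
   the step at time t consumes the first factor of the product. *)
Lemma recursion_independent t n A B C : (forall j, measurable (A j)) ->
  (forall j, measurable (B j)) -> measurable C ->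
  Pr (Y t @^-1` C `&` future A B t n) =
  (Pr (Y t @^-1` C) * \prod_(t <= j < n) (P (A j) * mu (B j)))%E.
Proof.
elim: t n A B C => [|t IH] n A B C mA mB mC.
  (* The initial state is constant, so the event on it is empty or the whole space. *)
  have [Cs0|Cs0] := pselect (C s0); last first.
    rewrite (_ : Y 0%N @^-1` C = set0) ?set0I ?measure0 ?mul0e//.
    by apply/seteqP; split => // w /=; rewrite Y0.
  rewrite (_ : Y 0%N @^-1` C = setT); last first.
    by apply/seteqP; split => // w _ /=; rewrite Y0.
  rewrite setTI probability_setT mul1e big_split/= -(Pr_bigcap n iidX mA).
  rewrite -(Pr_bigcap n iidZ mB) -indXZ; [|exact: sigma_of_bigcap|exact: sigma_of_bigcap].
  by congr (Pr _); rewrite -bigcapI.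
(* The induction hypothesis with a future of length one: the state is independent of the present
   sample. *)
have now A' B' C' : measurable A' -> measurable B' -> measurable C' ->
    Pr (Y t @^-1` A' `&` (X t @^-1` B' `&` Z t @^-1` C')) =
    (Pr (Y t @^-1` A') * (P B' * mu C'))%E.
  move=> mA' mB' mC'; have := IH t.+1 (fun=> B') (fun=> C') A' (fun=> mB') (fun=> mC') mA'.
  rewrite big_nat1 => <-; congr (Pr (_ `&` _)).
  apply/seteqP; split=> [w ? j /=|w]; last by apply; rewrite /= leqnn ltnSn.
  by rewrite ltnS -eqn_leq => /eqP <-.
have mU : measurable (Phi t @^-1` C) by rewrite -[X in measurable X]setTI; exact: mPhi.
have := @independent_event _ _ _ _ _ _ _ _ _ Pr P mu (Y t) (X t) (Z t)
  (recursion_measurable t) (mX t) (mZ t) (future A B t.+1 n)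
  (\prod_(t.+1 <= j < n) (P (A j) * mu (B j)))%E (measurable_future _ _ mA mB) now.
rewrite (_ : Y t.+1 @^-1` C =
  (fun w => (Y t w, (X t w, Z t w))) @^-1` (Phi t @^-1` C)); last first.
  by apply/seteqP; split=> w /=; rewrite YS.
apply => // A' B' C' mA' mB' mC'.
have [nt|tn] := leqP n t.
  rewrite big_geq 1?leqW// mule1 (_ : future _ _ _ _ = setT) ?setIT ?now//.
  apply/seteqP; split=> // w _ j /= /andP[tj jn].
  by have := leq_ltn_trans nt (leq_trans tj (ltnW jn)); rewrite ltnn.
(* Inserting the present box at index t merges it with the later events into one future starting at
   t, to which the induction hypothesis applies. *)
pose AA j := if j == t then B' else A j; pose BB j := if j == t then C' else B j.
have mAA j : measurable (AA j) by rewrite /AA; case: ifP.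
have mBB j : measurable (BB j) by rewrite /BB; case: ifP.
have := IH n AA BB A' mAA mBB mA'.
rewrite big_ltn// {2}/AA {2}/BB !eqxx.
rewrite (eq_big_nat _ _ (F2 := fun j => (P (A j) * mu (B j))%E)); last first.
  by move=> j /andP[tj _]; rewrite /AA /BB gtn_eqF.
rewrite muleA => <-; congr (Pr _); rewrite -setIA; congr (_ `&` _).
apply/seteqP; split=> [w [[XB ZC] Kw] j /= /andP[tj jn]|w Kw].
  rewrite /AA /BB; have [->//|jt] := eqVneq j t.
  by apply: Kw => /=; rewrite ltn_neqAle eq_sym jt tj.
split; first by have := Kw t; rewrite /= leqnn tn /AA /BB eqxx; apply.
move=> j /= /andP[tj jn]; have := Kw j; rewrite /= /AA /BB (gtn_eqF tj) jn (ltnW tj).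
exact.
Qed.

Lemma ge0_integral_recursion t (h : S * (TX * TZ) -> \bar R) :
  measurable_fun setT h -> (forall p, 0 <= h p)%E ->
  (\int[Pr]_w h (Y t w, (X t w, Z t w)) =
   \int[Pr]_w \int[P]_x \int[mu]_z h (Y t w, (x, z)))%E.
Proof.
move=> mh h0; apply: ge0_integral_freeze => //; first exact: recursion_measurable.
move=> A B C mA mB mC.
have := @recursion_independent t t.+1 (fun=> B) (fun=> C) A (fun=> mB) (fun=> mC) mA.
rewrite big_nat1 => <-; congr (Pr (_ `&` _)).
apply/seteqP; split=> [w ? j /=|w]; last by apply; rewrite /= leqnn ltnSn.
by rewrite ltnS -eqn_leq => /eqP <-.
Qed.

End recursion.

(** * Euclidean projection *)

Section projection.
Context {R : realType} {d : nat}.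
Variable Theta : set 'rV[R]_d.
Hypotheses (cvxT : cvx Theta) (cT : compact Theta) (T0 : Theta !=set0).
Implicit Types (p q y a g : 'rV[R]_d).

Definition is_proj y p := is_argmin Theta (fun q => norm2 (q - y) ^+ 2) p.

(** Completing the square: the two objectives differ by the positive factor 2 al and a term free of
    the variable. *)
Lemma prox_is_proj al g a p : 0 < al ->
  is_argmin Theta (prox_objective al g a) p -> is_proj (a - al *: g) p.
Proof.
move=> al0 [Tp hp]; split=> // q Tq; have := hp q Tq.
have E x : norm2 (x - (a - al *: g)) ^+ 2 =
    2 * al * prox_objective al g a x + (al ^+ 2 * dotp g g - 2 * al * dotp g a).
  rewrite /prox_objective !sqr_norm2 !(dotpDl, dotpDr, dotpNl, dotpNr, dotpZl, dotpZr).
  by rewrite (dotpC x a) (dotpC x g) (dotpC a g); field; rewrite gt_eqF.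
by rewrite !E => h; rewrite lerD2r ler_pM2l// mulr_gt0.
Qed.

Lemma proj_variational y p q : is_proj y p -> Theta q -> dotp (y - p) (q - p) <= 0.
Proof.
move=> [Tp hp] Tq; rewrite leNgt; apply/negP => c0.
set c := dotp (y - p) (q - p) in c0; set N := dotp (q - p) (q - p).
have N0 : 0 <= N by exact: dotp_ge0.
have cN : 0 < c + N by lra.
(* This step towards q satisfies s <= 1 and s N <= c even when N = 0, while minimality of p would
   force s N >= 2 c. *)
pose s := c / (c + N).
have s0 : 0 < s by rewrite divr_gt0.
have s1 : s <= 1 by rewrite ler_pdivrMr// mul1r; lra.
have := hp _ (cvxT (s := s) (introT andP (conj (ltW s0) s1)) Tq Tp).
have -> : s *: q + (1 - s) *: p - y = s *: (q - p) - (y - p).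
  by apply/rowP => j; rewrite !mxE; ring.
rewrite !sqr_norm2 (dotp_sqrB (s *: _)) !dotpZl dotpZr -/N (dotpC (q - p)) -/c.
have -> : dotp (p - y) (p - y) = dotp (y - p) (y - p).
  by rewrite -opprB dotpNl dotpNr opprK.
rewrite -subr_ge0 addrK.
have -> : s * (s * N) - 2 * (s * c) = s * (s * N - 2 * c) by ring.
rewrite pmulr_rge0// => h.
have : s * N <= c by rewrite /s mulrAC ler_pdivrMr// mulrDr lerDr sqr_ge0.
lra.
Qed.

Lemma proj_contract y p q : is_proj y p -> Theta q -> norm2 (p - q) ^+ 2 <= norm2 (y - q) ^+ 2.
Proof.
move=> hp Tq; have := proj_variational hp Tq.
have -> : y - q = (y - p) - (q - p) by rewrite opprB addrA subrK.
have -> : p - q = - (q - p) by rewrite opprB.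
rewrite norm2N !sqr_norm2 (dotp_sqrB (y - p)) => h; have := dotp_ge0 (y - p); lra.
Qed.

(** The two variational inequalities are added. The result gives uniqueness of the projection when y
    = y', and its continuity in general. *)
Lemma proj_nonexpansive y y' p p' : is_proj y p -> is_proj y' p' ->
  norm2 (p - p') <= norm2 (y - y').
Proof.
move=> hp hp'.
have h1 := proj_variational hp (proj1 hp'); have h2 := proj_variational hp' (proj1 hp).
have h : dotp (p - p') (p - p') <= dotp (y - y') (p - p').
  have -> : dotp (y - y') (p - p') =
      dotp (p - p') (p - p') - dotp (y - p) (p' - p) - dotp (y' - p') (p - p').
    rewrite !(dotpDl, dotpDr, dotpNl, dotpNr); ring.
  lra.
have [->|n0] := eqVneq (norm2 (p - p')) 0; first exact: norm2_ge0.
have np : 0 < norm2 (p - p') by rewrite lt0r n0 norm2_ge0.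
rewrite -(ler_pM2r np) -expr2 sqr_norm2 (le_trans h)// (le_trans (ler_norm _))//.
exact: dotp_CS.
Qed.

Lemma norm2_eq0 y : norm2 y = 0 -> y = 0.
Proof.
move=> y0; apply/rowP => i; rewrite mxE; apply/eqP.
by rewrite -normr_le0 -y0 ler_coord_norm2.
Qed.

Lemma is_proj_unique y p p' : is_proj y p -> is_proj y p' -> p = p'.
Proof.
move=> hp hp'; apply/eqP; rewrite -subr_eq0; apply/eqP/norm2_eq0/eqP.
have := proj_nonexpansive hp hp'; rewrite subrr /norm2 dotp0l sqrtr0 => h.
by rewrite eq_le h sqrtr_ge0.
Qed.

Lemma norm2_sub_continuous y : continuous (fun q : 'rV[R]_d => norm2 (q - y)).
Proof.
move=> q.
apply: (@continuous_comp _ _ _ (fun q : 'rV[R]_d => dotp (q - y) (q - y)) Num.sqrt);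
  last exact: sqrt_continuous.
suff sumC (s : seq 'I_d) : continuous (fun z : 'rV[R]_d =>
    \sum_(i <- s) (z - y) 0 i * (z - y) 0 i) by exact: sumC.
elim: s => [|i s IH] z.
  rewrite /continuous_at; under eq_fun do rewrite big_nil; rewrite big_nil.
  by apply: cvg_cst; exact: nbhs_filter.
have FF : Filter (nbhs z) by exact: nbhs_filter.
have zi : ((x - y) 0 i : R) @[x --> z] --> (z - y) 0 i.
  under eq_fun do rewrite 2!mxE; rewrite 2!mxE.
  by apply: cvgB; [exact: coord_continuous|exact: cvg_cst].
rewrite /continuous_at; under eq_fun do rewrite big_cons; rewrite big_cons.
by apply: cvgD; [exact: cvgM|exact: IH].
Qed.

Lemma is_proj_ex y : exists p, is_proj y p.
Proof.
have [|p] := @compact_EVT_min _ R (fun q => norm2 (q - y)) Theta T0 cT.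
  exact/continuous_subspaceT/norm2_sub_continuous.
rewrite inE => Tp hp; exists p; split=> // q Tq.
by rewrite lerXn2r ?nnegrE ?norm2_ge0// hp// inE.
Qed.

(** Continuity makes the projection Borel, so that the iterates become measurable functions of the
    past and the sample. *)
Lemma proj_function : exists pi : 'rV[R]_d -> 'rV[R]_d,
  continuous pi /\ forall y, is_proj y (pi y).
Proof.
have [pi hpi] := choice is_proj_ex; exists pi; split=> //.
apply: rV_continuous => i y; have FF : Filter (nbhs y) by exact: nbhs_filter.
apply/cvgrPdist_lt => e e0.
have := @norm2_sub_continuous y y.
rewrite /continuous_at subrr {2}/norm2 dotp0l sqrtr0 => /cvgrPdist_lt/(_ e e0).
apply: filterS => z; rewrite sub0r normrN ger0_norm ?norm2_ge0// => ze.
rewrite distrC (le_lt_trans _ ze)// (le_trans _ (proj_nonexpansive (hpi z) (hpi y)))//.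
have := ler_coord_norm2 (pi z - pi y) i; by rewrite !mxE.
Qed.

End projection.

(** * Sums of step sizes *)

Section sums.
Context {R : realType}.

Lemma abel_sum_le (D b : nat -> R) (M : R) k :
  (forall t, 0 <= D t <= M) -> (forall t, 0 <= b t <= b t.+1) ->
  \sum_(0 <= t < k.+1) (D t - D t.+1) * b t <= M * b k.
Proof.
move=> hD hb.
(* Keeping the last distance closes the induction: the next step leaves the gap (M - D_{k+1})
   (b_{k+1} - b_k) >= 0. *)
suff : \sum_(0 <= t < k.+1) (D t - D t.+1) * b t <= (M - D k.+1) * b k.
  move=> /le_trans; apply; have /andP[D0 _] := hD k.+1; have /andP[b0 _] := hb k.
  by rewrite mulrBl lerBlDr lerDl mulr_ge0.
elim: k => [|k IH].
  rewrite big_nat1; apply: ler_wpM2r; first by case/andP: (hb 0%N).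
  by rewrite lerD2r; case/andP: (hD 0%N).
rewrite big_nat_recr//=; apply: (le_trans (lerD IH (lexx _))).
have /andP[_ DM] := hD k.+1; have /andP[_ bk] := hb k.
rewrite -subr_ge0 (_ : _ - _ = (M - D k.+1) * (b k.+1 - b k)); last by ring.
by rewrite mulr_ge0// subr_ge0.
Qed.

(** Each term is at most sqrt(t+1) - sqrt(t), and these differences telescope. *)
Lemma sum_invsqrt_le k :
  \sum_(0 <= t < k) (2 * Num.sqrt t.+1%:R)^-1 <= Num.sqrt k%:R :> R.
Proof.
elim: k => [|k IH]; first by rewrite big_geq// sqrtr0.
rewrite big_nat_recr//=; apply: (le_trans (lerD IH (lexx _))).
set a := Num.sqrt k%:R; set b := Num.sqrt k.+1%:R.
have a0 : 0 <= a by exact: sqrtr_ge0.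
have b0 : 0 < b by rewrite sqrtr_gt0 ltr0n.
have ab : a <= b by rewrite ler_sqrt ?ler_nat// ltr0n.
have e : b ^+ 2 - a ^+ 2 = 1 by rewrite !sqr_sqrtr// -natr1; ring.
rewrite -lerBrDl -[leLHS]mul1r ler_pdivrMr ?mulr_gt0//.
by have := sqr_ge0 (b - a); rewrite !expr2 in e *; lra.
Qed.

Lemma sum_invsqr_le k : \sum_(0 <= t < k) (t.+1%:R ^+ 2)^-1 <= 2 :> R.
Proof.
case: k => [|k]; first by rewrite big_geq.
(* The sharper bound is inductive, since 1/(x+1)^2 <= 1/x - 1/(x+1). *)
apply: (@le_trans _ _ (2 - k.+1%:R^-1)); last by rewrite lerBlDr lerDl.
elim: k => [|k IH]; first by rewrite big_nat1 expr1n invr1; lra.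
rewrite big_nat_recr//=; apply: (le_trans (lerD IH (lexx _))).
have x0 : 0 < k.+1%:R :> R by rewrite ltr0n.
rewrite -(natr1 k.+1); set x := k.+1%:R in x0 *.
rewrite -subr_ge0 (_ : _ - _ = (x * (x + 1) ^+ 2)^-1).
  by rewrite invr_ge0 mulr_ge0 ?sqr_ge0// ltW.
by field; lra.
Qed.

Lemma sum_inv_le_ln k :
  \sum_(0 <= t < k.+1) (2 * t.+1%:R)^-1 <= ln (2 * k.+1%:R) :> R.
Proof.
(* ln y >= 1 - 1/y *)
have ln_ge (y : R) : 0 < y -> 1 - y^-1 <= ln y.
  move=> y0; have := @le_ln1Dx R (y^-1 - 1).
  rewrite ltrBrDl subrr invr_gt0 => /(_ y0).
  by rewrite addrC subrK lnV ?posrE//; lra.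
elim: k => [|k IH].
  (* The factor 2 inside the logarithm is there for this case, 1/2 <= ln 2; ln 1 would be too
     small. *)
  by rewrite big_nat1 mulr1; apply: le_trans (ln_ge 2 _) => //; lra.
rewrite big_nat_recr//=; apply: (le_trans (lerD IH (lexx _))).
have x0 : 0 < k.+1%:R :> R by rewrite ltr0n.
rewrite -(natr1 k.+1); set x := k.+1%:R in x0 *.
have x1 : 0 < x + 1 by lra.
rewrite (_ : 2 * (x + 1) = (2 * x) * ((x + 1) / x)); last by field; rewrite gt_eqF.
rewrite [leRHS]lnM ?posrE ?mulr_gt0 ?invr_gt0// lerD2l.
apply: le_trans (ln_ge _ _); last by rewrite divr_gt0.
rewrite invf_div -subr_ge0 (_ : _ - _ = (2 * (x + 1))^-1).
  by rewrite invr_ge0; lra.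
by field; lra.
Qed.

Lemma step_size_gt0 (rad G alpha : R) (d t : nat) : (0 < d)%N ->
  0 < rad -> 0 < G -> 0 < alpha -> 0 < step_size d rad G alpha t.+1.
Proof.
by move=> *; rewrite /step_size mulr_gt0// divr_gt0// !mulr_gt0// sqrtr_gt0 ltr0n.
Qed.

Lemma smoothingE (G LP u : R) (d t : nat) : (0 < d)%N -> 0 < LP ->
  smoothing d G LP u t.+1 = u * G / (LP * d%:R * t.+1%:R).
Proof.
move=> d0 LP0; rewrite /smoothing.
have dR : 0 < d%:R :> R by rewrite ltr0n.
have -> : d%:R `^ (3 / 2) = d%:R * Num.sqrt d%:R :> R.
  rewrite (_ : 3 / 2 = 1 + 2^-1); last by field.
  by rewrite powRD ?gt_eqF ?implybT// powRr1 ?ltW// powR12_sqrt// ltW.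
have s0 : 0 < Num.sqrt d%:R :> R by rewrite sqrtr_gt0.
by field; rewrite !gt_eqF// ltr0n.
Qed.

(** Put M = rad G sqrt(d) and count time from 1. The weights 1/(2 al) grow like sqrt(t), so the
    distances contribute at most M sqrt(k) / alpha. Divided by 2 al, the bias gives M u / (2 t), the
    subgradient part of the second moment M alpha / (2 sqrt(t)), and the squared bias M alpha u^2 /
    (8 t^(5/2)). The coefficients alpha^-1 and alpha of M sqrt(k) add up to at most twice their
    maximum. *)
Lemma regret_sum_le (rad G LP alpha u : R) (d k : nat) (D c : nat -> R) :
  (0 < d)%N -> 0 < rad -> 0 < G -> 0 < LP -> 0 < alpha -> 0 < u ->
  (forall t, 0 <= D t <= rad ^+ 2) ->
  let al t := step_size d rad G alpha t.+1 in
  let v t := smoothing d G LP u t.+1 in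
  (forall t, c t = al t * v t * LP * (d%:R * Num.sqrt d%:R * rad)
     + al t ^+ 2 * (2 * d%:R * G ^+ 2 + d%:R ^+ 3 * v t ^+ 2 * LP ^+ 2 / 2)) ->
  k.+1%:R^-1 * \sum_(0 <= t < k.+1) ((2 * al t)^-1 * (D t - D t.+1 + c t)) <=
  2 * (rad * G * Num.sqrt d%:R / Num.sqrt k.+1%:R) * Num.max alpha alpha^-1
      + alpha * u ^+ 2 * (rad * G * Num.sqrt d%:R / k.+1%:R)
      + u * (rad * G * Num.sqrt d%:R * ln (2 * k.+1%:R) / k.+1%:R).
Proof.
move=> d0 rad0 G0 LP0 a0 u0 hD al v hc.
set s := Num.sqrt d%:R; set M := rad * G * s.
have dR : 0 < d%:R :> R by rewrite ltr0n.
have s0 : 0 < s by rewrite sqrtr_gt0.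
have ss : s ^+ 2 = d%:R by rewrite sqr_sqrtr// ltW.
have M0 : 0 < M by rewrite !mulr_gt0.
have q0 t : 0 < Num.sqrt t.+1%:R :> R by rewrite sqrtr_gt0 ltr0n.
have n0 t : 0 < t.+1%:R :> R by rewrite ltr0n.
pose b t := (2 * al t)^-1.
have bE t : b t = G * s * Num.sqrt t.+1%:R / (alpha * rad).
  by rewrite /b /al /step_size -/s; field; rewrite !gt_eqF.
have -> : \sum_(0 <= t < k.+1) ((2 * al t)^-1 * (D t - D t.+1 + c t)) =
    \sum_(0 <= t < k.+1) (D t - D t.+1) * b t
    + (M * u * \sum_(0 <= t < k.+1) (2 * t.+1%:R)^-1
    + M * alpha * \sum_(0 <= t < k.+1) (2 * Num.sqrt t.+1%:R)^-1
    + M * alpha * u ^+ 2 / 8 * \sum_(0 <= t < k.+1) (t.+1%:R ^+ 2 * Num.sqrt t.+1%:R)^-1).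
  rewrite !mulr_sumr -!big_split /=; apply: eq_bigr => t _.
  rewrite hc /v smoothingE// /b /al /step_size -/s -ss /M.
  by field; rewrite !gt_eqF.
have h1 : \sum_(0 <= t < k.+1) (D t - D t.+1) * b t <= M * alpha^-1 * Num.sqrt k.+1%:R.
  apply: le_trans (@abel_sum_le D b (rad ^+ 2) k hD _) _ => [t|].
    rewrite !bE; apply/andP; split; first by rewrite divr_ge0 ?mulr_ge0 ?ltW.
    apply: ler_wpM2r; first by rewrite invr_ge0 mulr_ge0 ?ltW.
    apply: ler_wpM2l; first by rewrite mulr_ge0 ?ltW.
    by rewrite ler_sqrt// ler_nat.
  by rewrite bE /M le_eqVlt; apply/orP; left; apply/eqP; field; rewrite !gt_eqF.
have h2 : \sum_(0 <= t < k.+1) (t.+1%:R ^+ 2 * Num.sqrt t.+1%:R)^-1 <= 2 :> R.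
  apply: le_trans (sum_invsqr_le k.+1); apply: ler_sum => t _.
  rewrite lef_pV2 ?posrE ?mulr_gt0 ?exprn_gt0//.
  apply: ler_peMr; first by rewrite exprn_ge0// ltW.
  by rewrite -[leLHS]sqrtr1 ler_sqrt// ler1n.
have h3 := sum_invsqrt_le k.+1; have h4 := sum_inv_le_ln k.
rewrite mulrC ler_pdivrMr//.
set K := k.+1%:R : R; set q := Num.sqrt K.
have KE : K = q ^+ 2 by rewrite sqr_sqrtr// ltW.
have qp : 0 < q by exact: q0.
have -> : (2 * (M / q) * Num.max alpha alpha^-1 + alpha * u ^+ 2 * (M / K)
     + u * (M * ln (2 * K) / K)) * K =
   2 * M * q * Num.max alpha alpha^-1 + alpha * u ^+ 2 * M + u * M * ln (2 * K).
  by rewrite KE; field; rewrite gt_eqF.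
(* The resulting coefficient 1/4 stays below the 1 of the claim. *)
have g2 : M * alpha * u ^+ 2 / 8 * \sum_(0 <= t < k.+1) (t.+1%:R ^+ 2 * Num.sqrt t.+1%:R)^-1
    <= M * alpha * u ^+ 2 / 8 * 2.
  by apply: ler_wpM2l => //; rewrite !mulr_ge0 ?ltW.
have g3 : M * alpha * \sum_(0 <= t < k.+1) (2 * Num.sqrt t.+1%:R)^-1 <= M * alpha * q.
  by apply: ler_wpM2l => //; rewrite !mulr_ge0 ?ltW.
have g4 : M * u * \sum_(0 <= t < k.+1) (2 * t.+1%:R)^-1 <= M * u * ln (2 * K).
  by apply: ler_wpM2l => //; rewrite !mulr_ge0 ?ltW.
have m1 : M * q * alpha <= M * q * Num.max alpha alpha^-1.
  by apply: ler_wpM2l; [rewrite mulr_ge0 ?ltW|rewrite le_max lexx].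
have m2 : M * q * alpha^-1 <= M * q * Num.max alpha alpha^-1.
  by apply: ler_wpM2l; [rewrite mulr_ge0 ?ltW|rewrite le_max lexx orbT].
have w0 : 0 <= M * alpha * u ^+ 2 by rewrite !mulr_ge0 ?ltW// exprn_ge0 ?ltW.
rewrite -/K -/q in h1; lra.
Qed.

End sums.

(** * The excess risk *)

(** The integral of a nonnegative function is a supremum over the simple functions below it, which
    is monotone whether or not the function is measurable. *)
Lemma ge0_le_integral_nonmeasurable (dT : measure_display)
    (T : measurableType dT) (R : realType) (mu : measure T R) (h1 h2 : T -> \bar R) :
  (forall x, 0 <= h1 x)%E -> (forall x, h1 x <= h2 x)%E ->
  (\int[mu]_x h1 x <= \int[mu]_x h2 x)%E.
Proof.
move=> h10 h12; have h20 x : (0 <= h2 x)%E by exact: le_trans (h12 x).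
rewrite !ge0_integralTE//; apply: le_ereal_sup => _ [h hh <-].
by exists h => // x; exact: le_trans (h12 x).
Qed.

Lemma measurable_iterated_integral (d1 d2 d3 : measure_display) (T1 : measurableType d1)
    (T2 : measurableType d2) (T3 : measurableType d3) (R : realType)
    (P : probability T2 R) (mu : probability T3 R) (h : T1 * (T2 * T3) -> \bar R) :
  measurable_fun setT h -> (forall p, 0 <= h p)%E ->
  measurable_fun setT (fun a => \int[P]_x \int[mu]_z h (a, (x, z)))%E.
Proof.
move=> mh h0; pose Q : probability (T2 * T3)%type R := product_measure1 P mu.
rewrite (_ : (fun a => _) = fubini_F Q h); first exact: measurable_fun_fubini_tonelli_F.
apply/funext => a; rewrite /fubini_F /Q /= fubini_tonelli1//.
exact: (measurableT_comp mh
  (measurable_fun_pair (measurable_cst a) (@measurable_id _ _ setT))).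
Qed.

Section risk.
Context {R : realType} {d : nat} {dX : measure_display} {XX : measurableType dX}.
Variables (P : probability XX R) (F : 'rV[R]_d -> XX -> \bar R) (Theta : set 'rV[R]_d).
Variable g : 'rV[R]_d -> XX -> 'rV[R]_d.
Hypotheses (iF : forall a, Theta a -> P.-integrable setT (F a)) (cvxT : cvx Theta).
Hypothesis sub : forall a, Theta a -> subdifferential (risk P F) a (mean_vec P (g a)).
Let f := risk P F.

Lemma risk_fin a : Theta a -> f a \is a fin_num.
Proof. by move=> Ta; apply: integrable_fin_num => //; exact: iF. Qed.

Lemma risk_subgradient a b : Theta a -> Theta b ->
  fine (f a) + dotp (mean_vec P (g a)) (b - a) <= fine (f b).
Proof.
move=> Ta Tb; have := sub Ta b.
by rewrite -/f -(fineK (risk_fin Ta)) -(fineK (risk_fin Tb)) -EFinD lee_fin.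
Qed.

Lemma average_in (y : nat -> 'rV[R]_d) k :
  (0 < k)%N -> (forall t, (0 < t)%N -> Theta (y t)) ->
  Theta (average y k).
Proof.
move=> k0 Ty; rewrite /average.
have := @cvx_average _ _ Theta _ (index_iota 0 k) (y \o succn) cvxT.
by rewrite size_iota subn0 big_add1; apply => // t; exact: Ty.
Qed.

(** Jensen's inequality from the supporting hyperplane at the average, where the linear terms sum to
    zero. *)
Lemma risk_average_le (y : nat -> 'rV[R]_d) k : (0 < k)%N ->
  (forall t, (0 < t)%N -> Theta (y t)) ->
  fine (f (average y k)) <= k%:R^-1 * \sum_(0 <= t < k) fine (f (y t.+1)).
Proof.
move=> k0 Ty; have Ta := average_in k0 Ty.
set a := average y k in Ta *.
have kn0 : k%:R != 0 :> R by rewrite pnatr_eq0 -lt0n.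
have : \sum_(0 <= t < k) (fine (f a) + dotp (mean_vec P (g a)) (y t.+1 - a)) <=
    \sum_(0 <= t < k) fine (f (y t.+1)).
  by apply: ler_sum => t _; apply: risk_subgradient => //; exact: Ty.
rewrite big_split /= sumr_const_nat subn0 -dotp_sumr sumrB sumr_const_nat subn0.
have -> : \sum_(0 <= t < k) y t.+1 = a *+ k.
  by rewrite /a /average big_add1 -scaler_nat scalerA mulfV// scale1r.
rewrite subrr dotpC dotp0l addr0 -[_ *+ k]mulr_natl => h.
by rewrite ler_pdivlMl// ltr0n.
Qed.

End risk.

Theorem corollary1 (R : realType) (d : nat)
  (dX dO : measure_display)
  (XX : measurableType dX) (P : probability XX R)
  (Omega : measurableType dO) (Pr : probability Omega R)
  (mu : probability (borelRV R d) R)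
  (Theta : set 'rV[R]_d) (thetastar : 'rV[R]_d)
  (F : 'rV[R]_d -> XX -> \bar R) (g : 'rV[R]_d -> XX -> 'rV[R]_d)
  (L : XX -> R) (rad G alpha u : R)
  (X : nat -> Omega -> XX) (Z : nat -> Omega -> borelRV R d)
  (theta1 : 'rV[R]_d) (theta : nat -> Omega -> 'rV[R]_d) :
  let f := risk P F in
  let LP := rms P L in
  (0 < d)%N ->
  0 < rad -> 0 < G -> 0 < LP -> 0 < alpha -> 0 < u ->
  (* the problem *)
  compact Theta -> convex_set Theta ->
  measurable_fun setT (fun p : borelRV R d * XX => F p.1 p.2) ->
  {ae P, forall x, closed_convex (F^~ x)} ->
  (forall a, Theta a -> P.-integrable setT (F a)) ->
  is_argmin Theta f thetastar ->
  (* subgradient selection *)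
  (forall a, Theta a -> measurable_fun setT (g a : XX -> borelRV R d)) ->
  (forall a, Theta a -> {ae P, forall x, subdifferential (F^~ x) a (g a x)}) ->
  (forall a, Theta a -> subdifferential f a (mean_vec P (g a))) ->
  (forall a, Theta a ->
    (\int[P]_x (norm2 (g a x) ^+ 2)%:E <= (G ^+ 2)%:E)%E) ->
  (* geometry and smoothness *)
  (forall a, Theta a ->
    1 / 2 * norm2 (thetastar - a) ^+ 2 <= 1 / 2 * rad ^+ 2) ->
  Theta `<=` [set a | norm2 a <= rad] ->
  (forall x, [set a + smoothing d G LP u 1 *: z |
                a in Theta & z in msupport mu] `<=` edom (F^~ x)) ->
  measurable_fun setT L -> (forall x, 0 <= L x) ->
  (\int[P]_x (L x ^+ 2)%:E < +oo)%E ->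
  {ae P, forall x, lipschitz_gradient (F^~ x) (L x)} ->
  (* sampling *)
  uniform_on_sphere (Num.sqrt d%:R) mu ->
  iid Pr P (fun j => X j.+1) -> iid Pr mu (fun j => Z j.+1) ->
  independent_sequences Pr (fun j => X j.+1) (fun j => Z j.+1) ->
  (* the iterates *)
  Theta theta1 -> (forall w, theta 1%N w = theta1) ->
  (forall t w, (1 <= t)%N ->
    is_argmin Theta
      (prox_objective (step_size d rad G alpha t)
         (grad_estimate F (smoothing d G LP u t) (theta t w) (Z t w) (X t w))
         (theta t w))
      (theta t.+1 w)) ->
  forall k, (1 <= k)%N ->
  (\int[Pr]_w (f (average (theta ^~ w) k) - f thetastar) <=
     (2 * (rad * G * Num.sqrt d%:R / Num.sqrt k%:R) * Num.max alpha alpha^-1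
      + alpha * u ^+ 2 * (rad * G * Num.sqrt d%:R / k%:R)
      + u * (rad * G * Num.sqrt d%:R * ln (2 * k%:R) / k%:R))%:E)%E.
Proof.
move=> f LP d0 rad0 G0 LP0 a0 u0 cT cvxT mF Fcvx iF argts mg sub subf gG geo _ dom
  mL L0 L2oo Flip umu iidX iidZ indXZ T1 th1 thS [//|k] _.
have {}cvxT := convex_set_cvx cvxT.
have [Tts fmin] := argts.
have hL2 : has_mean P (fun x => L x ^+ 2) (LP ^+ 2).
  have L2b : (\int[P]_x (L x ^+ 2)%:E <= (fine (\int[P]_x (L x ^+ 2)%:E))%:E)%E.
    by rewrite fineK// ge0_fin_numE// integral_ge0// => x _; rewrite lee_fin sqr_ge0.
  have [m hm _] := has_mean_ge0 (measurable_funX 2 mL) (fun x => sqr_ge0 _) L2b.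
  suff <- : m = LP ^+ 2 by [].
  rewrite /LP /rms (proj2 hm) /= sqr_sqrtr// -lee_fin -(proj2 hm).
  by apply: integral_ge0 => x _; rewrite lee_fin sqr_ge0.
have dist_rad a : Theta a -> norm2 (a - thetastar) <= rad.
  move=> Ta; have := geo a Ta; rewrite ler_pM2l// -opprB norm2N.
  by rewrite ler_sqr ?nnegrE ?norm2_ge0 ?(ltW rad0).
pose al t := step_size d rad G alpha t.+1.
pose v t := smoothing d G LP u t.+1.
have al0 t : 0 < al t by exact: step_size_gt0.
have al20 t : 0 < 2 * al t by rewrite pmulr_rgt0.
have dR : 0 < d%:R :> R by rewrite ltr0n.
have v0 t : 0 < v t.
  by rewrite /v smoothingE// divr_gt0// !mulr_gt0// ltr0n.
have vle t : v t <= v 0%N.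
  rewrite /v !smoothingE// ler_wpM2l ?mulr_ge0 ?(ltW u0) ?(ltW G0)//.
  by rewrite lef_pV2 ?posrE ?mulr_gt0 ?ltr0n// ler_wpM2l ?mulr_ge0 ?(ltW LP0)// ler1n.
have [pi [cpi hpi]] := proj_function cvxT cT (ex_intro _ _ T1).
(* Index shift: [Y 0] is the first iterate, so [Y t] goes with the step size, radius and sample
   numbered t+1. *)
pose Y t w := theta t.+1 w : borelRV R d.
have TY t w : Theta (Y t w).
  by case: t => [|t]; rewrite /Y ?th1//; have [] := thS t.+1 w isT.
pose Phi t (p : borelRV R d * (XX * borelRV R d)) : borelRV R d :=
  pi (p.1 - al t *: grad_estimate F (v t) p.1 p.2.2 p.2.1).
have mPhi t : measurable_fun setT (Phi t).
  apply: (measurableT_comp (continuous_borel cpi)).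
  apply: rV_measurable => j.
  rewrite (_ : (fun p => _) = fun p : borelRV R d * (XX * borelRV R d) =>
    p.1 0 j - al t * grad_estimate F (v t) p.1 p.2.2 p.2.1 0 j); last first.
    by apply/funext => p; rewrite !mxE.
  apply: measurable_funB.
    exact: (measurableT_comp (measurable_coord j) measurable_fst).
  apply: measurable_funM => //.
  exact: (measurableT_comp (measurable_coord j) (grad_estimate_measurable mF (v t))).
have projY t w : is_proj Theta
    (Y t w - al t *: grad_estimate F (v t) (Y t w) (Z t.+1 w) (X t.+1 w)) (Y t.+1 w).
  by apply: prox_is_proj => //; exact: thS.
(* Uniqueness of the projection identifies the given minimizer with the value of the measurable map
   [Phi t]. *)
have YS t w : Y t.+1 w = Phi t (Y t w, (X t.+1 w, Z t.+1 w)).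
  exact: (is_proj_unique cvxT (projY t w) (hpi _)).
have mY t : measurable_fun setT (Y t).
  exact: (recursion_measurable iidX iidZ mPhi th1 YS).
pose dist2 t w := norm2 (Y t w - thetastar) ^+ 2.
have dist2_le t w : 0 <= dist2 t w <= rad ^+ 2.
  by rewrite sqr_ge0 /= lerXn2r ?nnegrE ?norm2_ge0// ?(ltW rad0)// dist_rad.
have mdist2 t : measurable_fun setT (dist2 t).
  apply: measurable_funX.
  suff mw : measurable_fun setT (fun w => Y t w - thetastar : borelRV R d).
    exact: (measurableT_comp (@norm2_borel R d) mw).
  apply: rV_measurable => j.
  rewrite (_ : (fun w => _) = fun w => Y t w 0 j - thetastar 0 j); last first.
    by apply/funext => w; rewrite !mxE.
  by apply: measurable_funB => //; exact: (measurableT_comp (measurable_coord j) (mY t)).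
have /choice[D hD] t : exists m, has_mean Pr (dist2 t) m.
  apply: (has_mean_ae_bounded (c := rad ^+ 2)) => //; apply: aeW => w.
  by rewrite ger0_norm; case/andP: (dist2_le t w).
have D_le t : 0 <= D t <= rad ^+ 2.
  apply/andP; split.
    apply: (has_mean_ae_le (has_mean_cst Pr 0) (hD t)); apply: aeW => w.
    by case/andP: (dist2_le t w).
  apply: (has_mean_ae_le (hD t) (has_mean_cst Pr _)); apply: aeW => w.
  by case/andP: (dist2_le t w).
pose c t := al t * v t * LP * (d%:R * Num.sqrt d%:R * rad)
   + al t ^+ 2 * (2 * d%:R * G ^+ 2 + d%:R ^+ 3 * v t ^+ 2 * LP ^+ 2 / 2).
have c0 t : 0 <= c t.
  rewrite /c; move: (al t) (v t) (ltW (al0 t)) (ltW (v0 t)) => x y x0 y0.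
  apply: addr_ge0; first by rewrite !mulr_ge0 ?sqrtr_ge0 ?(ltW LP0) ?(ltW rad0).
  apply: mulr_ge0; first exact: sqr_ge0.
  apply: addr_ge0; first by rewrite mulr_ge0 ?sqr_ge0// mulr_ge0.
  by rewrite divr_ge0// mulr_ge0 ?sqr_ge0// mulr_ge0 ?sqr_ge0// exprn_ge0.
(* This plays the conditional expectation, given the past, of the squared distance after the
   unprojected step: the state is frozen and the fresh sample is integrated out. *)
pose q t w := (\int[P]_x \int[mu]_z (sq_error F thetastar (al t) (v t) (Y t w) z x)%:E)%E.
have q_ge0 t w : (0 <= q t w)%E.
  by do 2 (apply: integral_ge0 => ? _); rewrite lee_fin sqr_ge0.
have q_le t w : (q t w <=
    (dist2 t w - 2 * al t * (fine (f (Y t w)) - fine (f thetastar)) + c t)%:E)%E.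
  (* The domain hypothesis concerns the first radius [v 0], which dominates all later ones. *)
  have := one_step_bound mF d0 umu mL L0 LP0 hL2 Fcvx Flip (g := g (Y t w)) (a := Y t w)
    (ts := thetastar) (al := al t) (v := v t) (u := v 0%N) (G := G) (rad := rad)
    (ltW (al0 t)) _ (dist_rad _ (TY t w)) _
    (mg _ (TY t w)) (sub _ (TY t w)) (gG _ (TY t w)).
  rewrite v0 vle => /(_ isT) h.
  apply: le_trans (h _) _ => [x z zs|].
    by apply: (dom x); exists (Y t w) => //; exists z.
  rewrite lee_fin -/(dist2 t w) /c -!addrA lerD2l lerD2r lerN2 (ler_pM2l (al20 t)).
  have := risk_subgradient iF subf (TY t w) Tts.
  by rewrite -(opprB (Y t w)) dotpNr -/f; lra.
have fE a : Theta a -> f a = (fine (f a))%:E by move=> Ta; rewrite fineK// (risk_fin iF).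
have excess_ge0 t w : 0 <= fine (f (Y t w)) - fine (f thetastar).
  have := fmin _ (TY t w).
  by rewrite (fE _ (TY t w)) (fE _ Tts) lee_fin subr_ge0.
have mq t : measurable_fun setT (q t).
  have mh : measurable_fun setT (EFin \o (fun p : borelRV R d * (XX * borelRV R d) =>
      sq_error F thetastar (al t) (v t) p.1 p.2.2 p.2.1)).
    by apply/measurable_EFinP; exact: sq_error_measurable.
  have mQ := measurable_iterated_integral P mu mh (fun p => sqr_ge0 _).
  exact: (measurableT_comp mQ (mY t)).
have fq t w : q t w \is a fin_num.
  by rewrite ge0_fin_numE// (le_lt_trans (q_le t w))// ltry.
have /choice[mq_ hq] t : exists m, has_mean Pr (fun w => fine (q t w)) m.
  apply: (has_mean_ae_bounded (c := rad ^+ 2 + c t)); first exact: measurableT_comp.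
  apply: aeW => w; rewrite ger0_norm ?fine_ge0//.
  have := q_le t w; rewrite -(fineK (fq t w)) lee_fin => /le_trans; apply.
  rewrite lerD2r; have /andP[_] := dist2_le t w; have := excess_ge0 t w.
  by move=> h; have := mulr_ge0 (ltW (al0 t)) h; lra.
(* Averaging [q t] over the state gives the mean squared distance after the unprojected step, and
   projecting can only decrease it. *)
have Dq t : D t.+1 <= mq_ t.
  rewrite -lee_fin -(proj2 (hD t.+1)) -(proj2 (hq t)).
  have mh : measurable_fun setT (EFin \o (fun p : borelRV R d * (XX * borelRV R d) =>
      sq_error F thetastar (al t) (v t) p.1 p.2.2 p.2.1)).
    by apply/measurable_EFinP; exact: sq_error_measurable.
  under [leRHS]eq_integral do rewrite fineK//.
  have := ge0_integral_recursion iidX iidZ indXZ mPhi th1 YS t mh (fun p => sqr_ge0 _).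
  rewrite /q => <-; apply: ge0_le_integral_nonmeasurable => w; rewrite lee_fin ?sqr_ge0//.
  exact: (proj_contract cvxT (projY t w) Tts).
(* delta t dominates the excess risk at time t; unlike the latter it is
   measurable by construction. *)
pose delta t w := (2 * al t)^-1 * (dist2 t w - fine (q t w) + c t).
have hdelta t : has_mean Pr (delta t) ((2 * al t)^-1 * (D t - mq_ t + c t)).
  by apply: has_meanZ; apply: has_meanD; [exact: has_meanB|exact: has_mean_cst].
have excess_le t w : fine (f (Y t w)) - fine (f thetastar) <= delta t w.
  rewrite /delta (ler_pdivlMl _ _ (al20 t)).
  by have := q_le t w; rewrite -(fineK (fq t w)) lee_fin; lra.
have hmean := has_meanZ k.+1%:R^-1
  (has_mean_sum (index_iota 0 k.+1) (fun t (_ : xpredT t) => hdelta t)).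
apply: (@le_trans _ _
  (k.+1%:R^-1 * \sum_(0 <= t < k.+1) ((2 * al t)^-1 * (D t - mq_ t + c t)))%:E).
  rewrite -(proj2 hmean).
  have Tth w t : (0 < t)%N -> Theta (theta t w) by case: t => // t _; exact: TY.
  have Tav w : Theta (average (theta ^~ w) k.+1).
    by apply: (average_in cvxT) => // t; exact: Tth.
  apply: ge0_le_integral_nonmeasurable => w.
    have := fmin _ (Tav w); rewrite (fE _ (Tav w)) (fE _ Tts) lee_fin => favg.
    by rewrite -EFinB lee_fin subr_ge0.
  rewrite (fE _ (Tav w)) (fE _ Tts) -EFinB lee_fin.
  have := risk_average_le iF cvxT subf (isT : (0 < k.+1)%N) (Tth w).
  rewrite -/f => h; apply: le_trans (_ : k.+1%:R^-1 * \sum_(0 <= t < k.+1)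
    (fine (f (Y t w)) - fine (f thetastar)) <= _).
    rewrite sumrB sumr_const_nat subn0 mulrBr -[fine (f thetastar) *+ _]mulr_natl.
    by rewrite mulKf ?pnatr_eq0// lerD2r.
  by rewrite ler_wpM2l ?invr_ge0//; apply: ler_sum => t _; exact: excess_le.
rewrite lee_fin.
(* Since [D t.+1 <= mq_ t], replacing [mq_ t] by [D t.+1] increases each term and produces the
   differences needed for summation by parts. *)
apply: le_trans
  (@regret_sum_le R rad G LP alpha u d k D c d0 rad0 G0 LP0 a0 u0 D_le _) => //.
rewrite ler_wpM2l ?invr_ge0//; apply: ler_sum => t _.
by rewrite ler_pM2l ?invr_gt0// lerD2r lerB.
Qed.
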